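(* Let $d, N\in \mathbb{N}$ and let $X= (X_n)_{n\in[N]}$ be a random point set in $[0,1)^d$. 1. If $X$ is a Monte Carlo point set, then there exists a realization $P\subset [0,1)^d$ of $X$ such that $$D^*_N(P) \leq 2.5287 \cdot\sqrt{\frac{d}{N}}.$$ The probability that $X$ satisfies $D^*_N(X) \leq 3\cdot\sqrt{d/N}$ is at least $0.987256$, and the probability that $X$ satisfies $D^*_N(X) \leq 4\cdot\sqrt{d/N}$ is at least $0.999999$. 2. If $X$ is a Latin hypercube sample or a Latin hypercube sample padded by Monte Carlo, then there exists a realization $P\subset [0,1)^d$ of $X$ such that $$D^*_N(P) \leq 2.6442 \cdot\sqrt{\frac{d}{N}}.$$ The probability that $X$ satisfies $D^*_N(X) \leq 3\cdot\sqrt{d/N}$ is at least $0.965358$, and the probability that $X$ satisfies $D^*_N(X) \leq 4\cdot\sqrt{d/N}$ is at least $0.999999$. Moreover (as a consequence of the first estimate in 1.), for every $d\in\mathbb{N}$, $$N^*(\varepsilon ,d) \le \left\lceil 6.3944 \cdot d\, \varepsilon^{-2} \right\rceil \quad\text{for all } \varepsilon >0.$$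
   Context: Notation: $[N]=\{1,\dots,N\}$; $\lambda^d$ is Lebesgue measure on $\mathbb{R}^d$; for $x,y\in\mathbb{R}^d$, $[x,y):=\prod_{j=1}^d[x_j,y_j)$. A realization of $X$ is the point (multi)set $(X_n(\omega))_{n\in[N]}$ for some $\omega$ in the underlying probability space. Star discrepancy: for an $N$-point multiset $P=\{p_1,\dots,p_N\}\subset[0,1)^d$ (points counted with multiplicity) and measurable $T\subseteq[0,1)^d$ put $D_N(P,T):=\big|\frac1N|P\cap T|-\lambda^d(T)\big|$, and $D_N^*(P):=\sup_{y\in[0,1]^d}D_N(P,[0,y))$. Put $D^*(N,d):=\inf\{D_N^*(P)\mid P\subset[0,1)^d,\ |P|=N\}$ for $N\ge 1$ (with the convention $D^*(0,d):=1$) and $N^*(\varepsilon,d):=\inf\{N\in\mathbb{N}_0\mid D^*(N,d)\le\varepsilon\}$. Monte Carlo point set: independent random points uniformly distributed in $[0,1)^d$. Latin hypercube sample: a Latin hypercube sample $(X_n)_{n=1}^N$ in $[0,1)^d$ is of the form $X_{n,j}=\frac{\pi_j(n-1)+U_{n,j}}{N}$, where $X_{n,j}$ is the $j$th coordinate of $X_n$, each $\pi_j$ is a permutation of $0,1,\dots,N-1$ chosen uniformly at random, each $U_{n,j}$ is uniformly distributed in $[0,1)$, and the $d$ permutations $\pi_j$ and the $dN$ random variables $U_{n,j}$ are mutually independent. Latin hypercube sample padded by Monte Carlo: $X_n=(Y_n,V_n)$, $n\in[N]$, where $d=d'+d''$ with $d',d''\in\mathbb{N}$, $(Y_n)_{n=1}^N$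 is a Latin hypercube sample in $[0,1)^{d'}$, and $(V_n)_{n=1}^N$ are independent uniformly distributed random points in $[0,1)^{d''}$, independent of $(Y_n)_{n=1}^N$. *)

(* Defs.v *)
From HB Require Import structures.
From mathcomp Require Import all_boot all_order all_algebra all_fingroup.
From mathcomp Require Import all_classical all_reals all_analysis.

Set Implicit Arguments.
Unset Strict Implicit.
Unset Printing Implicit Defensive.

Import Order.TTheory GRing.Theory Num.Theory.
Import numFieldNormedType.Exports.

Local Open Scope classical_set_scope.
Local Open Scope ring_scope.

(** Points of R^d are [d.-tuple R], which carries the product sigma-algebra.
    An N-point multiset in R^d is a family [p : 'I_N -> d.-tuple R]. *)

Section Discrepancy.
Context {R : realType}.
Implicit Types d N : nat.

(** d-dimensional Lebesgue measure on the Borel sets, as a d-fold product. *)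
Fixpoint lebesgue_tuple d : set (d.-tuple R) -> \bar R :=
  match d with
  | 0 => fun A => \d_([tuple] : 0.-tuple R) A
  | d'.+1 => pushforward (lebesgue_measure \x @lebesgue_tuple d')%E
               (fun xt : R * d'.-tuple R => [tuple of xt.1 :: xt.2])
  end.

Definition box d (x y : d.-tuple R) : set (d.-tuple R) :=
  [set t | forall j, tnth x j <= tnth t j < tnth y j].

Definition zero_tuple d : d.-tuple R := [tuple 0 | j < d].
Definition one_tuple d : d.-tuple R := [tuple 1 | j < d].

Definition unit_cube d : set (d.-tuple R) := box (zero_tuple d) (one_tuple d).

Definition closed_unit_cube d : set (d.-tuple R) :=
  [set t | forall j, 0 <= tnth t j <= 1].

Definition discrepancy N d (p : 'I_N -> d.-tuple R) (T : set (d.-tuple R)) : R :=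
  `| N%:R^-1 * #|[pred n | p n \in T]|%:R - fine (lebesgue_tuple T) |.

Definition star_discrepancy N d (p : 'I_N -> d.-tuple R) : R :=
  sup [set discrepancy p (box (zero_tuple d) y) | y in @closed_unit_cube d].

Definition min_star_discrepancy N d : R :=
  if N == 0%N then 1
  else inf [set star_discrepancy p |
              p in [set p : 'I_N -> d.-tuple R | forall n, unit_cube (p n)]].

(** The infimum is taken in the extended reals, so that it is [+oo] when no N
    qualifies (a real [inf] would be 0). *)
Definition inverse_star_discrepancy (eps : R) d : \bar R :=
  ereal_inf [set (N%:R)%:E | N in [set N | min_star_discrepancy N d <= eps]].

End Discrepancy.

Section PermMeasurable.
Context (T : finType).
HB.instance Definition _ := isPointed.Build (perm_type T) (1%g : {perm T}).
HB.instance Definition _ := @isMeasurable.Build default_measure_display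
  (perm_type T) discrete_measurable discrete_measurable0
  discrete_measurableC discrete_measurableU.
End PermMeasurable.

Section RandomPoints.
Context {R : realType} {dO : measure_display} {Omega : measurableType dO}.
Variable P : probability Omega R.
Implicit Types d N : nat.

Definition independent_systems (I : finType) (F : I -> set (set Omega)) : Prop :=
  forall (J : {set I}) (A : I -> set Omega),
    (forall i, i \in J -> F i (A i)) ->
    P (\bigcap_(i in [set` J]) A i) = (\prod_(i in J) P (A i))%E.

Definition uniform_on_unit_interval (U : {RV P >-> R}) : Prop :=
  (forall w, 0 <= U w < 1) /\
  (forall A : set R, measurable A ->
     distribution P U A = uniform_prob (@ltr01 R) A).

Definition uniform_on_unit_cube d (V : {RV P >-> d.-tuple R}) : Prop :=
  forall A : set (d.-tuple R), measurable A ->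
    distribution P V A = lebesgue_tuple (A `&` @unit_cube R d).

Definition uniform_permutation N (s : {RV P >-> {perm 'I_N}}) : Prop :=
  forall t : {perm 'I_N}, distribution P s [set t] = ((N`!)%:R^-1)%:E.

Definition monte_carlo N d (X : 'I_N -> {RV P >-> d.-tuple R}) : Prop :=
  (forall n, uniform_on_unit_cube (X n)) /\
  independent_systems (fun n => g_sigma_algebra_preimage (X n)).

Definition latin_hypercube N d (X : 'I_N -> {RV P >-> d.-tuple R}) : Prop :=
  exists (s : 'I_d -> {RV P >-> {perm 'I_N}}) (U : 'I_N -> 'I_d -> {RV P >-> R}),
  [/\ forall j, uniform_permutation (s j),
      forall n j, uniform_on_unit_interval (U n j),
      independent_systems (fun k : 'I_d + 'I_N * 'I_d =>
        match k with
        | inl j => g_sigma_algebra_preimage (s j)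
        | inr (n, j) => g_sigma_algebra_preimage (U n j)
        end)
    & forall n j w, tnth (X n w) j = ((s j w n)%:R + U n j w) / N%:R].

Definition joint N d (X : 'I_N -> {RV P >-> d.-tuple R}) (w : Omega) :
  N.-tuple (d.-tuple R) := [tuple X n w | n < N].

Definition independent_families N d d' (Y : 'I_N -> {RV P >-> d.-tuple R})
    (V : 'I_N -> {RV P >-> d'.-tuple R}) : Prop :=
  forall (A : set (N.-tuple (d.-tuple R))) (B : set (N.-tuple (d'.-tuple R))),
    measurable A -> measurable B ->
    P ((joint Y @^-1` A) `&` (joint V @^-1` B)) =
    (P (joint Y @^-1` A) * P (joint V @^-1` B))%E.

Definition padded_latin_hypercube N d (X : 'I_N -> {RV P >-> d.-tuple R}) : Prop :=
  exists (d1 d2 : nat) (Y : 'I_N -> {RV P >-> d1.-tuple R})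
         (V : 'I_N -> {RV P >-> d2.-tuple R}),
  [/\ [/\ (0 < d1)%N, (0 < d2)%N & d = (d1 + d2)%N],
      latin_hypercube Y, monte_carlo V, independent_families Y V
    & forall n w, X n w = Y n w ++ V n w :> seq R].

Definition realization N d (X : 'I_N -> {RV P >-> d.-tuple R})
    (p : 'I_N -> d.-tuple R) : Prop :=
  exists w, forall n, p n = X n w.

End RandomPoints.

Arguments monte_carlo {R dO Omega} P {N d} X.
Arguments latin_hypercube {R dO Omega} P {N d} X.
Arguments padded_latin_hypercube {R dO Omega} P {N d} X.

(* Main.v *)
Require Import Defs.
From mathcomp Require Import all_boot all_order all_algebra all_fingroup.
From mathcomp Require Import all_classical all_reals all_analysis.
From mathcomp Require Import measurable_realfun.
From mathcomp Require Import ring lra zify.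

(** Why the bounds hold.  Put [rho = sqrt (d / N)].  Since the star
    discrepancy is at most 1, only [c * rho <= 1] matters.

    Passing to a grid.  Cut every axis into [N] cells and let box corners range
    over the multiples of [1 / N].  This changes the discrepancy by at most
    [d / N = rho ^ 2] ([discrepancy_le_corners]).  On the grid a sample is
    known once the cell of every coordinate of every point is known.  These
    cells form [d] maps from ['I_N] to ['I_N], the columns, which are
    independent.  A Monte Carlo column is a uniformly random map.  A Latin
    hypercube column is a uniformly random permutation, whatever the offsets
    inside the cells are.  A padded sample has columns of both kinds.

    Negative dependence.  For a random permutation [s] and nested sets [A n],
    the probability that [s n] lies in [A n] for all [n] is at most the product
    of the densities of the [A n] ([card_allowed_le]).  Take grid points
    [a <= b] and let [S] be the complement of [[0, b) \ [0, a)].  If all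
    coordinates but one are fixed, the sections of [S] are nested.  Replacing
    the columns one at a time by uniform ones therefore only increases the
    probability that given points all lie in [S], so the number of points in
    [S] has at most the moment generating function of a binomial variable
    ([expect_mgf_avoid]).  No constant is lost, so that Latin hypercube samples
    satisfy the estimates proved for Monte Carlo samples.

    Tails.  Because [S] may be any box or the complement of any box, Hoeffding's
    inequality holds for the local discrepancy of a box in both directions.
    Moreover the shortfall of points in an increment [[0, b) \ [0, a)] of volume
    at most [delta] is sub-Gaussian with variance proxy [delta / N].

    Chaining.  Rounding the running product of the coordinates down to
    multiples of [1 / m] sorts the grid points into at most ['C(m + d, d)]
    classes, and each class lies in a bracket [lo <= y <= up] whose volume gap
    is at most [d / m] ([bracketing_cover]).  With [m = d * n] the gap is
    [1 / n], and there are at most [e ^ (d - 1) * (n + 1) ^ d] brackets.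
    An excess of points in [[0, y)] is bounded by the excess in [[0, up)] plus
    the shortfall in the increment, and a lack of points by the lack in
    [[0, lo)] plus the shortfall in the increment.  So both directions chain
    through shortfalls only, from fine brackets to coarse ones.

    Constants.  For [rho >= 1/100] the single resolution [2 ^ 8] suffices.
    Otherwise the resolutions are [2 ^ 12], [2 ^ 16], [2 ^ 20] and so on.  The
    coarsest level gets the deviation [(c - 3/10) * rho], and the others, with
    [rho / 2 ^ (k + 3)] for [k = 0, 1, 2...], share [rho / 4].  The bound
    on the failure probability is largest for [d = 1], where it is a numerical
    expression in [c].  It is below 1 already for [c = 2.52], which is used
    for both existence statements and for the inverse discrepancy, the latter
    with uniform weights on the columns. *)

Set Implicit Arguments.
Unset Strict Implicit.
Unset Printing Implicit Defensive.
Import Order.TTheory GRing.Theory Num.Theory.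
Import numFieldNormedType.Exports.

Local Open Scope ring_scope.

(** * Columns of a Latin hypercube are negatively dependent *)

Section PermCount.
Variables (N : nat) (A : 'I_N -> {set 'I_N}).

Let allowed (D : {set 'I_N}) : {set {perm 'I_N}} :=
  [set s : {perm 'I_N} | [forall (n | n \in D), s n \in A n]].

(** Composing with the transposition of [m] and [r] exchanges the conditions on
    the values at [m] and at [r]. *)
Lemma card_allowed_swap (D : {set 'I_N}) (m r : 'I_N) : m \notin D -> r \notin D ->
  #|[set s in allowed D | s r \in A m]| = #|allowed (m |: D)|.
Proof.
move=> mD rD; rewrite -(card_imset _ (mulgI (tperm m r))).
congr #|pred_of_set _|; apply/finset.setP => t; apply/imsetP/idP.
- case=> s; rewrite !inE => /andP[/forall_inP sD srm] ->.
  apply/forall_inP => n; rewrite !inE permM => /predU1P[->|nD].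
    by rewrite tpermL.
  rewrite tpermD ?sD //.
    by apply: contraNneq mD => ->.
  by apply: contraNneq rD => ->.
- rewrite inE => /forall_inP tD; exists (tperm m r * t)%g; last first.
    by rewrite mulgA tperm2 mul1g.
  rewrite !inE permM tpermR tD ?finset.setU11 // andbT.
  apply/forall_inP => n nD; rewrite permM tpermD ?tD ?inE ?nD ?orbT //.
    by apply: contraNneq mD => ->.
  by apply: contraNneq rD => ->.
Qed.

(** Double counting of the pairs [(s, r)] with [s r \in A m] and [r] outside
    [D].  The values of [s] on [D] use up #|D| elements of [A m], so that
    #|A m| - #|D| of the remaining [r] qualify, and by symmetry each [r]
    contributes as much as [m] does. *)
Lemma card_allowed_add (D : {set 'I_N}) (m : 'I_N) : m \notin D ->
  (forall n, n \in D -> A n \subset A m) ->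
  ((N - #|D|) * #|allowed (m |: D)| = (#|A m| - #|D|) * #|allowed D|)%N.
Proof.
move=> mD sub.
transitivity (\sum_(r in ~: D) \sum_(s in allowed D) (s r \in A m : nat))%N.
  have -> : (N - #|D|)%N = #|~: D|.
    apply/eqP; rewrite -(eqn_add2l #|D|) subnKC ?cardsC ?card_ord //.
    by rewrite -[leqRHS](card_ord N) max_card.
  rewrite -sum_nat_const.
  apply: eq_bigr => r; rewrite inE => rD.
  rewrite -(card_allowed_swap mD rD) -sum1_card.
  rewrite [RHS]big_mkcond [LHS]big_mkcond; apply: eq_bigr => s _.
  by rewrite inE; case: (s \in allowed D) => //=; case: (s r \in A m).
rewrite exchange_big mulnC -sum_nat_const; apply: eq_bigr => s.
rewrite inE => /forall_inP sD.
rewrite -big_mkcondr sum1dep_card.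
have -> : [set x in ~: D | s x \in A m] = (s @^-1: A m) :\: D.
  by apply/finset.setP => x; rewrite !inE.
rewrite cardsD (finset.setIidPr _); last first.
  by apply/fintype.subsetP => n nD; rewrite inE (fintype.subsetP (sub _ nD)) ?sD.
by rewrite (card_preimset _ (@perm_inj _ s)).
Qed.

(** Remove the index with the largest set first, and use
    [(#|A m| - k) / (N - k) <= #|A m| / N]. *)
Lemma card_allowed_le (D : {set 'I_N}) :
  (forall n m, (A n \subset A m) || (A m \subset A n)) ->
  (#|allowed D| * N ^ #|D| <= N`! * \prod_(n in D) #|A n|)%N.
Proof.
move=> chA; have [k] := ubnP #|D|; elim: k D => // k IH D.
have [->|[n0 n0D]] := set_0Vmem D.
  move=> _; rewrite cards0 expn0 muln1 big_set0 muln1.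
  by apply: leq_trans (max_card _) _; rewrite card_Sn.
(* [m] has the largest set, which contains all the others *)
case: (arg_maxnP (fun n => #|A n|) n0D) => m mD0 maxm; have mD : m \in D := mD0.
have -> : D = m |: (D :\ m) by rewrite finset.setD1K.
have mD' : m \notin D :\ m by rewrite !inE eqxx.
have sub n : n \in D :\ m -> A n \subset A m.
  rewrite !inE => /andP[_ nD]; have /orP[//|smn] := chA n m.
  by have /eqP -> : A m == A n by rewrite eqEcard smn; apply: maxm.
rewrite cardsU1 mD' ltnS add1n => /IH{}IH.
rewrite (big_setU1 _ mD') /=.
have ltDN : (#|D :\ m| < N)%N.
  have := subset_leq_card (finset.subsetT D).
  by rewrite cardsT card_ord (cardsD1 m) mD.
have NB : (0 < N - #|D :\ m|)%N by rewrite subn_gt0.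
rewrite -(leq_pmul2l NB) mulnA (card_allowed_add mD' sub) expnS.
have AmN : (#|A m| <= N)%N.
  by have := subset_leq_card (finset.subsetT (A m)); rewrite cardsT card_ord.
have key : ((#|A m| - #|D :\ m|) * N <= (N - #|D :\ m|) * #|A m|)%N.
  by rewrite !mulnBl mulnC leq_sub2l // mulnC [leqRHS]mulnC leq_mul2r AmN orbT.
have := leq_mul key IH; rewrite [X in (X <= _)%N -> _]mulnACA.
by rewrite -!mulnA => /leq_trans; apply; rewrite leq_mul2l mulnCA leqnn orbT.
Qed.

End PermCount.

Notation column N := {ffun 'I_N -> 'I_N}.

Section Columns.
Variables (R : realFieldType) (N : nat).
Implicit Types (A : 'I_N -> {set 'I_N}).

Definition nested A := forall n m, (A n \subset A m) || (A m \subset A n).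

(** The form of negative dependence that random permutations have.  It fails for
    arbitrary families [A]: disjoint sets attract different points. *)
Definition column_neg_dep (w : column N -> R) :=
  (forall g, 0 <= w g) /\
  forall A, nested A ->
    \sum_(g : column N | [forall n, g n \in A n]) w g <= \prod_n (#|A n|%:R / N%:R).

Definition uniform_column (g : column N) : R := (N%:R^-1) ^+ N.

(** The weight [1 / N`!] of a permutation, written as a sum over permutations so
    that it can be summed over maps by exchanging the two sums. *)
Definition permutation_column (g : column N) : R :=
  \sum_(s : {perm 'I_N} | finfun s == g) (N`!)%:R^-1.

Lemma uniform_column_family A :
  \sum_(g : column N | [forall n, g n \in A n]) uniform_column g =
  \prod_n (#|A n|%:R / N%:R).
Proof.
under [RHS]eq_bigr do rewrite mulr_natl -sumr_const.
rewrite (bigA_distr_big_dep (fun i j => j \in A i)) /=.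
apply: eq_big => [g|g _]; first by apply/forallP/familyP.
by rewrite prodr_const card_ord.
Qed.

Lemma uniform_column_neg_dep : column_neg_dep uniform_column.
Proof.
split=> [g|A _]; first by rewrite exprn_ge0 ?invr_ge0.
by rewrite uniform_column_family.
Qed.

Lemma permutation_column_neg_dep : column_neg_dep permutation_column.
Proof.
split=> [g|A chA]; first by apply: sumr_ge0 => s _; rewrite invr_ge0.
rewrite /permutation_column (exchange_big_dep xpredT) //=.
have -> : \sum_(s : {perm 'I_N}) \sum_(g : column N | [forall n, g n \in A n] &&
    (finfun s == g)) (N`!)%:R^-1 =
  \sum_(s : {perm 'I_N} | [forall (n | n \in [set: 'I_N]), s n \in A n]) (N`!)%:R^-1 :> R.
  rewrite [RHS]big_mkcond; apply: eq_bigr => s _.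
  rewrite (eq_bigl (fun g : column N => (g == finfun s) && [forall n, g n \in A n])).
    rewrite big_mkcondr big_pred1_eq.
  2: by move=> g; rewrite andbC eq_sym.
  have -> : [forall n, finfun s n \in A n] = [forall (n | n \in [set: 'I_N]), s n \in A n].
    by apply/forallP/forall_inP => [H n _|H n]; have := H n; rewrite ffunE // => ->.
  by [].
rewrite sumr_const big_split /= -[X in X *+ _]mul1r -mulrnAl.
rewrite prodr_const card_ord exprVn -natrX -natr_prod -[X in X <= _]/(_ / _).
have Ngt0 : (0 < N ^ N)%N by rewrite expn_gt0 lt0n orNb.
rewrite ler_pdivrMr ?ltr0n ?fact_gt0 // mulrAC ler_pdivlMr ?ltr0n //.
rewrite -!natrM ler_nat.
have := card_allowed_le [set: 'I_N] chA.
rewrite cardsT card_ord cardsE.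
by rewrite [X in _ -> (_ <= X)%N]mulnC; under [in X in X -> _]eq_bigl do rewrite finset.in_setT.
Qed.

(** Expectation over [d] independent columns with weights [w 0], ..., [w d.-1].
    It is a nested sum because columns are treated one at a time. *)
Fixpoint expect (w : nat -> column N -> R) d (F : seq (column N) -> R) : R :=
  if d is d'.+1 then
    \sum_g w 0%N g * expect (fun j => w j.+1) d' (fun l => F (g :: l))
  else F [::].

Lemma eq_expect (w : nat -> column N -> R) d F G : F =1 G -> expect w d F = expect w d G.
Proof.
elim: d w F G => [|d IH] w F G FG /=; first exact: FG.
by apply: eq_bigr => g _; congr (_ * _); apply: IH.
Qed.

Lemma expect_sum (I : Type) (r : seq I) (P : pred I) (w : nat -> column N -> R) d
    (F : I -> seq (column N) -> R) :
  expect w d (fun l => \sum_(i <- r | P i) F i l) = \sum_(i <- r | P i) expect w d (F i).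
Proof.
elim: d w F => //= d IH w F; rewrite exchange_big /=.
by apply: eq_bigr => g _; rewrite IH mulr_sumr.
Qed.

Lemma expectZ (w : nat -> column N -> R) d c F :
  expect w d (fun l => c * F l) = c * expect w d F.
Proof.
elim: d w F => //= d IH w F; rewrite mulr_sumr.
by apply: eq_bigr => g _; rewrite IH mulrCA.
Qed.

Lemma expect_mix (v : column N -> R) (w : nat -> column N -> R) d F :
  \sum_g v g * expect w d (F g) = expect w d (fun l => \sum_g v g * F g l).
Proof. by rewrite expect_sum; apply: eq_bigr => g _; rewrite expectZ. Qed.

Lemma expect_le (w : nat -> column N -> R) d F G : (forall j g, 0 <= w j g) ->
  (forall l, size l = d -> F l <= G l) -> expect w d F <= expect w d G.
Proof.
elim: d w F G => [|d IH] w F G w0 FG /=; first exact: FG.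
apply: ler_sum => g _; rewrite ler_wpM2l // IH // => l sl.
by rewrite FG //= sl.
Qed.

Fixpoint inbox (l : seq (column N)) (a : seq nat) (n : 'I_N) : bool :=
  if l is g :: l' then
    if a is x :: a' then (g n < x)%N && inbox l' a' n else true
  else true.

Definition vol (a : seq nat) : R := \prod_(x <- a) (x%:R / N%:R).

Lemma inbox_mono l a b n : all2 leq a b -> inbox l a n -> inbox l b n.
Proof.
elim: l a b => // g l IH [|x a] [|y b] //= /andP[xy ab] /andP[gx la].
by rewrite (leq_trans gx xy) /=; apply: IH la.
Qed.

(** No point lies in the increment from [a] to [b].  The flags record whether
    the coordinates already read keep point [n] below [a], respectively [b];
    with [inB n = false] point [n] is not constrained at all. *)
Definition avoids (inA inB : 'I_N -> bool) a b l : bool :=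
  [forall n, inA n && inbox l a n || ~~ (inB n && inbox l b n)].

(** Each column is replaced by a uniform one while the others are fixed: the
    induction hypothesis does this for the later columns, and the sections seen
    by the first column are nested. *)
Lemma expect_avoids_le_uniform w d a b (inA inB : 'I_N -> bool) :
  (forall j, column_neg_dep (w j)) -> all2 leq a b ->
  size a = d -> (forall n, inA n -> inB n) ->
  expect w d (fun l => (avoids inA inB a b l)%:R) <=
  expect (fun=> uniform_column) d (fun l => (avoids inA inB a b l)%:R).
Proof.
elim: d w a b inA inB => [|d IH] w a b inA inB wnd //.
case: a b => [|x a] [|y b] //= /andP[xy ab] [szd] AB.
have avE g l : avoids inA inB (x :: a) (y :: b) (g :: l) =
    avoids (fun n => inA n && (g n < x)%N) (fun n => inB n && (g n < y)%N) a b l.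
  by apply: eq_forallb => n; rewrite /= !andbA.
apply: (@le_trans _ _ (\sum_g w 0%N g * expect (fun=> uniform_column) d
    (fun l => (avoids inA inB (x :: a) (y :: b) (g :: l))%:R))).
  apply: ler_sum => g _; apply: ler_wpM2l; first by case: (wnd 0%N).
  under eq_expect do rewrite avE; under [leRHS]eq_expect do rewrite avE.
  apply: IH => // n /andP[/AB -> gx].
  exact: leq_trans gx xy.
rewrite 2!expect_mix.
apply: expect_le => [j g|l _]; first by case: uniform_column_neg_dep.
pose A n := [set c : 'I_N | (inA n && inbox l a n) && (c < x)%N
                            || ~~ ((inB n && inbox l b n) && (c < y)%N)].
have E (g : column N) :
    avoids inA inB (x :: a) (y :: b) (g :: l) = [forall n, g n \in A n].
  apply: eq_forallb => n; rewrite inE /=.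
  by rewrite -!andbA; congr (_ && _ || ~~ (_ && _)); rewrite andbC.
have sumE (v : column N -> R) : \sum_g v g *
    (avoids inA inB (x :: a) (y :: b) (g :: l))%:R =
    \sum_(g : column N | [forall n, g n \in A n]) v g.
  rewrite [RHS]big_mkcond; apply: eq_bigr => g _; rewrite E.
  by case: ifP; rewrite ?mulr1 ?mulr0.
rewrite !sumE uniform_column_family; case: (wnd 0%N) => _; apply.
(* A section only depends on two flags, the first one implying the second. *)
pose sec (p q : bool) := [set c : 'I_N | p && (c < x)%N || ~~ (q && (c < y)%N)].
have secE n : A n = sec (inA n && inbox l a n) (inB n && inbox l b n) by [].
have secF p : sec p false = finset.setT by apply/finset.setP => c; rewrite !inE orbT.
have secT : sec false true \subset sec true true.
  by apply/fintype.subsetP => c; rewrite !inE /= => ->; rewrite orbT.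
move=> n m; rewrite !secE.
case Qn: (inB n && _); last by rewrite secF finset.subsetT orbT.
case Qm: (inB m && _); last by rewrite [in X in X || _]secF finset.subsetT.
case: (inA n && _); case: (inA m && _); rewrite ?subxx ?secT ?orbT //.
Qed.

Lemma sum_ord_ltn (x : nat) (u v : R) : (x <= N)%N ->
  \sum_(c < N) (if (c < x)%N then u else v) = x%:R * u + (N%:R - x%:R) * v.
Proof.
move=> xN; rewrite (bigID (fun c : 'I_N => (c < x)%N)) /=.
rewrite (eq_bigr (fun=> u)); last by move=> c ->.
rewrite [X in _ + X](eq_bigr (fun=> v)); last by move=> c /negbTE ->.
have cx : #|[pred c : 'I_N | (c < x)%N]| = x.
  have -> : #|[pred c : 'I_N | (c < x)%N]| = #|[set widen_ord xN i | i : 'I_x]|.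
    apply: eq_card => c; rewrite !inE; apply/idP/imsetP => [cx|[i _ ->]] /=.
      by exists (Ordinal cx) => //; apply: val_inj.
    exact: ltn_ord.
  rewrite card_imset ?card_ord // => i j /(congr1 val) /= ij; exact: val_inj.
have cy : #|[pred c : 'I_N | ~~ (c < x)%N]| = (N - x)%N.
  have := cardC [pred c : 'I_N | (c < x)%N]; rewrite cx card_ord => NE.
  apply/eqP; rewrite -(eqn_add2l x) subnKC // -[X in _ == X]NE eqn_add2l.
  by apply/eqP/eq_card => i; rewrite !inE.
by rewrite !sumr_const cx cy mulrnBr // -[u *+ x]mulr_natl mulrBl !mulr_natl.
Qed.

(** With uniform columns the points are independent and uniform. *)
Lemma expect_uniform_avoids d a b (inA inB : 'I_N -> bool) : (0 < N)%N ->
  size a = d -> all2 leq a b -> all (fun x => x <= N)%N b ->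
  (forall n, inA n -> inB n) ->
  expect (fun=> uniform_column) d (fun l => (avoids inA inB a b l)%:R) =
  \prod_n (1 - (inB n)%:R * vol b + (inA n)%:R * vol a).
Proof.
move=> N0; elim: d a b inA inB => [|d IH] a b inA inB /=.
  case: a b => [|//] [|//] _ _ _ AB; rewrite /vol !big_nil /avoids /=.
  have [/forallP H|] := boolP [forall n, inA n && true || ~~ (inB n && true)].
    rewrite big1 // => n _; have := H n; rewrite !andbT => /orP[An|nBn].
      by rewrite An (AB _ An); ring.
    have nAn : inA n = false by apply/negbTE/(contra (AB n)).
    by rewrite (negbTE nBn) nAn; ring.
  rewrite negb_forall => /existsP[n]; rewrite !andbT negb_or negbK => /andP[An Bn].
  by rewrite (bigD1 n) //= Bn (negbTE An) mulr1 mul0r subrr addr0 mul0r.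
case: a b => [//|x a] [//|y b] [szd] /= /andP[xy ab] /andP[yN bN] AB.
have avE g l : avoids inA inB (x :: a) (y :: b) (g :: l) =
    avoids (fun n => inA n && (g n < x)%N) (fun n => inB n && (g n < y)%N) a b l.
  by apply: eq_forallb => n; rewrite /= !andbA.
have step (g : column N) : uniform_column g * expect (fun=> uniform_column) d
    (fun l => (avoids inA inB (x :: a) (y :: b) (g :: l))%:R) =
  \prod_n (N%:R^-1 * (1 - (inB n && (g n < y)%N)%:R * vol b
                  + (inA n && (g n < x)%N)%:R * vol a)).
  under eq_expect do rewrite avE.
  rewrite IH //; last by move=> n /andP[/AB -> /leq_trans]; apply.
  by rewrite big_split /= prodr_const card_ord.
under eq_bigr do rewrite step.
rewrite -(bigA_distr_bigA (fun n (c : 'I_N) => N%:R^-1 *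
   (1 - (inB n && (c < y)%N)%:R * vol b + (inA n && (c < x)%N)%:R * vol a))) /=.
apply: eq_bigr => n _; rewrite -mulr_sumr.
have NR : N%:R != 0 :> R by rewrite pnatr_eq0 -lt0n.
rewrite big_split /= sumrB sumr_const card_ord.
have xN := leq_trans xy yN.
have -> : \sum_(i < N) (inB n && (i < y)%N)%:R * vol b = (inB n)%:R * y%:R * vol b.
  rewrite -mulr_suml; congr (_ * _).
  have := @sum_ord_ltn y (inB n)%:R 0 yN; rewrite mulr0 addr0 [_ * y%:R]mulrC => <-.
  by apply: eq_bigr => i _; case: (inB n); case: (i < y)%N.
have -> : \sum_(i < N) (inA n && (i < x)%N)%:R * vol a = (inA n)%:R * x%:R * vol a.
  rewrite -mulr_suml; congr (_ * _).
  have := @sum_ord_ltn x (inA n)%:R 0 xN; rewrite mulr0 addr0 [_ * x%:R]mulrC => <-.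
  by apply: eq_bigr => i _; case: (inA n); case: (i < x)%N.
rewrite /vol !big_cons; field.
exact: NR.
Qed.

(** Expand [u = 1 + (u - 1)] at every point of the complement, and bound the
    term of each set [J] of points by negative dependence. *)
Lemma expect_mgf_avoid w d a b u : (0 < N)%N -> (forall j, column_neg_dep (w j)) ->
  size a = d -> all2 leq a b -> all (fun x => x <= N)%N b -> 1 <= u ->
  expect w d (fun l => u ^+ #|[pred n | inbox l a n || ~~ inbox l b n]|) <=
  (1 + (u - 1) * (1 - vol b + vol a)) ^+ N.
Proof.
move=> N0 wnd sza ab bN u1.
have u0 : 0 <= u - 1 by rewrite subr_ge0.
pose F (J : {set 'I_N}) l := avoids (fun n => n \in J) (fun n => n \in J) a b l.
have E l : u ^+ #|[pred n | inbox l a n || ~~ inbox l b n]| =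
    \sum_(J : {set 'I_N}) (u - 1) ^+ #|J| * (F J l)%:R.
  have -> : u ^+ #|[pred n | inbox l a n || ~~ inbox l b n]| =
     \prod_(n < N) (1 + (u - 1) * (inbox l a n || ~~ inbox l b n)%:R).
    rewrite -prodr_const big_mkcond; apply: eq_bigr => n _ /=; rewrite inE.
    by case: (_ || _); rewrite ?mulr1 ?mulr0 ?addr0 // addrC subrK.
  under eq_bigr do rewrite addrC.
  rewrite bigA_distr /=; apply: eq_big => // J _.
  rewrite -big_mkcond big_split /= prodr_const; congr (_ * _).
  rewrite /F; have [/forallP H|] := boolP (avoids _ _ _ _ _).
    rewrite big1 // => n nJ; have := H n; rewrite nJ /=.
    by move=> ->.
  rewrite negb_forall => /existsP[n Hn].
  have [nJ|nJ] := boolP (n \in J); last by move: Hn; rewrite (negbTE nJ).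
  by rewrite (bigD1 n) //=; move: Hn; rewrite nJ /= => /negbTE ->; rewrite mul0r.
under eq_expect do rewrite E.
rewrite expect_sum.
apply: (@le_trans _ _ (\sum_(J : {set 'I_N})
     (u - 1) ^+ #|J| * (1 - vol b + vol a) ^+ #|J|)).
  apply: ler_sum => J _; rewrite expectZ ler_wpM2l ?exprn_ge0 //.
  apply: le_trans (expect_avoids_le_uniform wnd ab sza (fun n nJ => nJ)) _.
  rewrite expect_uniform_avoids //.
  rewrite (bigID (fun n => n \in J)) /= [X in _ * X]big1 ?mulr1; last first.
    by move=> n /negbTE; rewrite ?inE => -> /=; rewrite !mul0r subr0 addr0.
  rewrite -prodr_const le_eqVlt; apply/orP; left; apply/eqP.
  by apply: eq_bigr => n; rewrite ?inE => -> /=; rewrite !mul1r.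
under eq_bigr do rewrite -exprMn.
rewrite -[N in leRHS]card_ord -prodr_const.
under [leRHS]eq_bigr do rewrite addrC.
rewrite bigA_distr /= le_eqVlt; apply/orP; left; apply/eqP.
by apply: eq_big => // J _; rewrite -big_mkcond prodr_const.
Qed.

End Columns.

(** * A bracketing cover of the anchored boxes *)

(** The least and the greatest [t <= N] with [m * t %/ N = k], when there are
    any. *)
Definition cell_lo N m k := ((k * N + m.-1) %/ m)%N.
Definition cell_up N m k := (if m == 0 then N else minn N ((k.+1 * N).-1 %/ m))%N.

(** Brackets are indexed by the sequences [m >= k_1 >= ... >= k_d] which arise
    from [k_(j+1) = k_j * y_j %/ N].  In units of [1 / m], [k_j] is the rounded
    volume of the box spanned by the first [j] coordinates of [y / N]. *)
Fixpoint cover N m d : seq (seq nat * seq nat) :=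
  if d is d'.+1 then
    [seq (cell_lo N m k :: b.1, cell_up N m k :: b.2) | k <- iota 0 m.+1, b <- cover N k d']
  else [:: ([::], [::])].

(** The last condition says in integers that the volumes of the two boxes differ
    by at most [d / m]. *)
Definition bracket_ok N m d (b : seq nat * seq nat) : bool :=
  [&& size b.1 == d, all2 leq b.1 b.2, all (fun x => x <= N)%N b.2
    & (m * \prod_(x <- b.2) x <= m * \prod_(x <- b.1) x + d * N ^ d)%N].

(** The binomial coefficient counts the weakly decreasing sequences of length
    [d] with values up to [m]. *)
Lemma size_cover N m d : (size (cover N m d) <= 'C(m + d, d))%N.
Proof.
elim: d m => [|d IH] m; first by rewrite bin0.
have -> : size (cover N m d.+1) = sumn [seq size (cover N k d) | k <- iota 0 m.+1].
  exact: size_allpairs_dep.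
have H n : (sumn [seq size (cover N k d) | k <- iota 0 n.+1] <= 'C(n + d.+1, d.+1))%N.
  elim: n => [|n IHn].
    by rewrite /= addn0 add0n binn (leq_trans (IH 0%N)) // add0n binn.
  rewrite -(addn1 n.+1) iotaD map_cat sumn_cat [sumn (map _ (iota (0 + n.+1) 1))]/= addn0.
  (* hockey-stick summation *)
  rewrite addSn binS leq_add ?add0n //.
  by rewrite (leq_trans (IH n.+1)) // addSnnS.
exact: H.
Qed.

Lemma all2_size_leq (a b : seq nat) : all2 leq a b -> size a = size b.
Proof. by elim: a b => [|x a IH] [|y b] //= /andP[_ /IH ->]. Qed.

Lemma prod_le_expn N (y : seq nat) : all (fun x => x <= N)%N y ->
  (\prod_(x <- y) x <= N ^ size y)%N.
Proof.
elim: y => [|x y IH] /=; first by rewrite big_nil.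
by case/andP=> xN /IH yN; rewrite big_cons expnS leq_mul.
Qed.

(** Each coordinate adds at most one unit [1 / m] to the volume gap, since
    [m * up <= (k + 1) * N] and [k * N <= m * lo]. *)
Lemma coverP N m d y : (0 < N)%N -> size y = d -> all (fun x => x <= N)%N y ->
  exists2 b, b \in cover N m d & [&& bracket_ok N m d b, all2 leq b.1 y & all2 leq y b.2].
Proof.
move=> N0; elim: d m y => [|d IH] m [|t y] //=.
  by move=> _ _; exists ([::], [::]); rewrite ?inE // /bracket_ok /= leq_addr.
case=> szy /andP[tN yN].
set k := (m * t %/ N)%N.
have [b bc /and3P[/and4P[/eqP sb ab bN bvol] by1 by2]] := IH k y szy yN.
have km : (k <= m)%N.
  by rewrite -(mulnK m N0) leq_div2r // leq_mul2l tN orbT.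
have k1 : (k * N <= m * t)%N by exact: leq_divM.
have k2 : (m * t < k.+1 * N)%N by rewrite -ltn_divLR.
have lo_t : (cell_lo N m k <= t)%N.
  rewrite /cell_lo; case: (posnP m) k1 => [->|m0 k1]; first by rewrite divn0.
  by rewrite -ltnS ltn_divLR //; nia.
have t_up : (t <= cell_up N m k)%N.
  rewrite /cell_up; case: (posnP m) k2 => [->//|m0 k2].
  by rewrite leq_min tN leq_divRL //; nia.
have up_N : (cell_up N m k <= N)%N.
  by rewrite /cell_up; case: ifP => // _; exact: geq_minl.
have lo_vol : (k * N <= m * cell_lo N m k)%N.
  rewrite /cell_lo; case: (posnP m) km => [->|m0 _]; first by rewrite leqn0 => /eqP ->.
  have := divn_eq (k * N + m.-1) m; have := ltn_pmod (k * N + m.-1) m0.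
  by set q := (_ %/ _)%N; set r := (_ %% _)%N => H1 H2; nia.
have up_vol : (m * cell_up N m k <= k.+1 * N)%N.
  rewrite /cell_up; case: (posnP m) k2 => [->//|m0 k2].

  apply: (@leq_trans (m * ((k.+1 * N).-1 %/ m))); first by rewrite leq_mul2l geq_minr orbT.
  by rewrite mulnC (leq_trans (leq_divM _ _)) // leq_pred.
exists (cell_lo N m k :: b.1, cell_up N m k :: b.2).
  change ((cell_lo N m k :: b.1, cell_up N m k :: b.2) \in cover N m d.+1).
  apply/flatten_mapP; exists k; first by rewrite mem_iota add0n ltnS.
  by apply/mapP; exists b.
rewrite /bracket_ok /= sb eqxx lo_t t_up up_N ab bN by1 by2 (leq_trans lo_t t_up) /= !andbT.
rewrite !big_cons.
have U : (\prod_(x <- b.2) x <= N ^ d)%N.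
  by rewrite -sb (all2_size_leq ab) prod_le_expn.
move: bvol U; set Lo := \prod_(x <- b.1) x; set Up := \prod_(x <- b.2) x => bvol U.
rewrite !mulnA.
apply: (@leq_trans (k.+1 * N * Up)); first by rewrite leq_mul2r up_vol orbT.
apply: (@leq_trans (k * N * Lo + d.+1 * N ^ d.+1)); last first.
  by rewrite leq_add2r leq_mul2r lo_vol orbT.
rewrite expnS mulSn; set P := (N ^ d)%N in bvol U *.
have : (k * Up * N <= (k * Lo + d * P) * N)%N by rewrite leq_mul2r bvol orbT.
have : (N * Up <= N * P)%N by rewrite leq_mul2l U orbT.
by nia.
Qed.

Lemma bracketing_cover N m d : (0 < N)%N ->
  exists B : seq (seq nat * seq nat),
  [/\ (size B <= 'C(m + d, d))%N,
      forall b, b \in B -> bracket_ok N m d b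
    & forall y, size y = d -> all (fun x => x <= N)%N y ->
        exists2 b, b \in B & all2 leq b.1 y && all2 leq y b.2].
Proof.
move=> N0; exists [seq b <- cover N m d | bracket_ok N m d b]; split.
- by rewrite size_filter (leq_trans (count_size _ _)) // size_cover.
- by move=> b; rewrite mem_filter => /andP[].
- move=> y sy yN; have [b bc /and3P[ok h1 h2]] := coverP m N0 sy yN.
  by exists b; rewrite ?mem_filter ?ok ?h1.
Qed.

(** * Exponential inequalities *)

Lemma ffact_le_expn m k : (m ^_ k <= m ^ k)%N.
Proof.
elim: k m => [|k IH] m; first by rewrite ffactn0.
rewrite ffactnS expnS leq_mul2l (leq_trans (IH _)) ?orbT //.
by case: k {IH} => // k; rewrite leq_exp2r // leq_pred.
Qed.

Section ExpBounds.
Variable R : realType.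
Implicit Types (q s x : R).

Lemma ge0_of_derive_ge0 (f df : R -> R) : (forall x, is_derive x 1 f (df x)) ->
  f 0 = 0 -> (forall x, 0 <= x -> 0 <= df x) -> forall x, 0 <= x -> 0 <= f x.
Proof.
move=> fdf f0 df0 x x0.
have [|c c0 E] := MVT_segment x0 (fun y _ => fdf y).
  apply: continuous_subspaceT => y; apply: differentiable_continuous.
  by apply/derivable1_diffP; case: (fdf y).
move: E; rewrite f0 !subr0 => ->; apply: mulr_ge0 => //; apply: df0.
by move: c0; rewrite in_itv /= => /andP[].
Qed.

Lemma expRN_le_quadratic s : 0 <= s -> expR (- s) <= 1 - s + s ^+ 2 / 2.
Proof.
move=> s0; rewrite -subr_ge0; move: s s0.
apply: (@ge0_of_derive_ge0 _ (fun s => -1 + s + expR (- s))) => [x||x x0].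
- apply: is_derive_eq.
  by rewrite /GRing.scale /=; field.
- by rewrite subr0 oppr0 expR0 expr0n /= mul0r; ring.
- have := expR_ge1Dx (- x); lra.
Qed.

(** With [m x = 1 + (expR x - 1) * q], the second derivative of [ln (m x)] is at
    most [1 / 4] by the inequality between arithmetic and geometric means. *)
Lemma hoeffding_bernoulli q s : 0 <= q <= 1 -> 0 <= s ->
  1 + (expR s - 1) * q <= expR (s * q + s ^+ 2 / 8).
Proof.
case/andP=> q0 q1 s0.
pose m x := 1 + (expR x - 1) * q.
have m0 x : 0 < m x.
  rewrite /m; have := expR_gt0 x; nra.
rewrite -[leLHS]lnK ?posrE ?m0 // ler_expR -subr_ge0; move: s s0.
have dm x : is_derive x 1 m (expR x * q).
  by apply: is_derive_eq; rewrite /GRing.scale /=; ring.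
apply: (@ge0_of_derive_ge0 _ (fun x => q + x / 4 - 1 + (1 - q) / m x)) => [x||].
- have dl : is_derive x 1 (fun y => ln (m y)) ((m x)^-1 * (expR x * q)).
    by apply: (@is_derive1_comp _ (@ln R) m); exact: is_derive1_ln.
  apply: is_derive_eq; rewrite /GRing.scale /=.
  have mx : m x != 0 by rewrite gt_eqF.
  have -> : expR x * q = m x - 1 + q by rewrite /m; ring.
  by field.
- rewrite mul0r expr0n /= mul0r add0r expR0 subrr mul0r addr0 ln1; ring.
apply: (@ge0_of_derive_ge0 _ (fun x => 1 / 4 - (1 - q) * (expR x * q) / m x ^+ 2)) => [x||x x0].
- have dl : is_derive x 1 (fun y => (m y)^-1) (- (m x) ^- 2 *: (expR x * q)).
    by apply: is_deriveV; rewrite gt_eqF.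
  apply: is_derive_eq; rewrite /GRing.scale /=; field.
  by rewrite gt_eqF.
- by rewrite /m expR0; field.
- rewrite subr_ge0 ler_pdivrMr ?exprn_gt0 // /m.
  by have := expR_gt0 x; have := sqr_ge0 (1 - q - expR x * q); nra.
Qed.

Lemma expR1_ge : 27 / 10 <= expR 1 :> R.
Proof.
have -> : (1 : R) = 128%:R * (1 / 128) by field.
rewrite expRM_natl; apply: (@le_trans _ _ ((1 + 1 / 128) ^+ 128)); first lra.
by rewrite lerXn2r ?nnegrE ?expR_ge0 ?expR_ge1Dx //; lra.
Qed.

Lemma expR1_le : expR 1 <= 3 :> R.
Proof.
rewrite -[leLHS]invrK -expRN -[leRHS]invrK lef_pV2 ?posrE ?invr_gt0 ?expR_gt0 //.
have -> : (-1 : R) = 6%:R * (- (1 / 6)) by field.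
rewrite expRM_natl; apply: (@le_trans _ _ ((5 / 6) ^+ 6)); first lra.
by rewrite lerXn2r ?nnegrE ?expR_ge0 //; have := expR_ge1Dx (- (1 / 6) : R); lra.
Qed.

(** Induction with [(1 + 1 / d) ^ d <= e].  The exponent [d] instead of [d.+1]
    of [expR 1] is what keeps the bounds sharp enough in dimension one. *)
Lemma expn_le_fact_expR d : (d.+1 ^ d.+1)%:R <= d.+1`!%:R * expR 1 ^+ d :> R.
Proof.
elim: d => [|d IH]; first by rewrite expr0 mulr1.
have step : (d.+2%:R / d.+1%:R) ^+ d.+1 <= expR 1 :> R.
  have dK : d.+1%:R * d.+1%:R^-1 = 1 :> R by rewrite mulfV ?pnatr_eq0.
  rewrite -[in leRHS]dK expRM_natl lerXn2r ?nnegrE ?expR_ge0 ?divr_ge0 //.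
  apply: le_trans (expR_ge1Dx _).
  by rewrite -natr1 mulrDl mulfV ?pnatr_eq0 // mul1r.
rewrite expnS natrM factS natrM -mulrA ler_wpM2l // exprSr mulrA.
apply: le_trans (ler_pM _ _ IH step); rewrite ?mulr_ge0 ?exprn_ge0 ?divr_ge0 //.
by rewrite natrX expr_div_n natrX mulrC divfK // expf_neq0 ?pnatr_eq0.
Qed.

Lemma bin_le_expR d n :
  'C(d.+1 * n + d.+1, d.+1)%:R <= expR 1 ^+ d * n.+1%:R ^+ d.+1 :> R.
Proof.
rewrite -(ler_pM2l (_ : 0 < d.+1`!%:R)) ?ltr0n ?fact_gt0 // mulrA.
apply: le_trans (ler_wpM2r _ (expn_le_fact_expR d)); last by rewrite exprn_ge0.
rewrite -natrX -!natrM ler_nat mulnC bin_ffact -expnMn mulnSr.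
exact: ffact_le_expn.
Qed.

End ExpBounds.

(** * Tail bounds for the discrepancy of one box and of one increment *)

Section Tails.
Variables (R : realType) (N d : nat) (w : nat -> column N -> R).
Hypotheses (N0 : (0 < N)%N) (d0 : (0 < d)%N) (wnd : forall j, column_neg_dep (w j)).
Implicit Types (l : seq (column N)) (a b y : seq nat) (A B : seq (column N) -> bool).

Definition Pr (A : seq (column N) -> bool) : R := expect w d (fun l => (A l)%:R).

Lemma Pr_le A B : (forall l, size l = d -> A l -> B l) -> Pr A <= Pr B.
Proof.
move=> AB; apply: expect_le => [j g|l sl]; first by case: (wnd j).
by rewrite ler_nat; have := AB l sl; case: (A l) => // ->.
Qed.

Lemma Pr_or A B : Pr (fun l => A l || B l) <= Pr A + Pr B.
Proof.
have -> : Pr A + Pr B = expect w d (fun l => \sum_(i : bool) (if i then A l else B l)%:R).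
  by rewrite expect_sum big_bool.
apply: expect_le => [j g|l _]; first by case: (wnd j).
by rewrite big_bool /=; case: (A l); case: (B l); rewrite -natrD ler_nat.
Qed.

Lemma Pr_has (I : eqType) (s : seq I) (A : I -> seq (column N) -> bool) (e : R) :
  (forall i, i \in s -> Pr (A i) <= e) -> Pr (fun l => has (A^~ l) s) <= (size s)%:R * e.
Proof.
elim: s => [|i s IH] se /=.
  rewrite mul0r -[leRHS](mul0r (expect w d (fun=> 0))) -expectZ.
  by apply: expect_le => [j g|l _]; [case: (wnd j) | rewrite mul0r].
apply: le_trans (Pr_or _ _) _; rewrite -natr1 mulrDl mul1r addrC lerD //.
  by apply: IH => j js; apply: se; rewrite inE js orbT.
by apply: se; rewrite inE eqxx.
Qed.

Definition hits l y : nat := #|[pred n | inbox l y n]|.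

Definition local_disc l y : R := (hits l y)%:R / N%:R - vol R N y.

Lemma hits_mono l a b : all2 leq a b -> (hits l a <= hits l b)%N.
Proof.
by move=> ab; apply: subset_leq_card; apply/fintype.subsetP => n; rewrite !inE; exact: inbox_mono.
Qed.

Lemma vol_ge0 y : 0 <= vol R N y.
Proof. by rewrite /vol big_seq; apply: prodr_ge0 => x _; rewrite divr_ge0. Qed.

Lemma vol_mono a b : all2 leq a b -> vol R N a <= vol R N b.
Proof.
elim: a b => [|x a IH] [|y b] //= /andP[xy /IH ab].
rewrite /vol !big_cons; apply: ler_pM => //; first exact: vol_ge0.
by rewrite ler_wpM2r ?invr_ge0 // ler_nat.
Qed.

Lemma vol_le1 y : all (fun x => x <= N)%N y -> vol R N y <= 1.
Proof.
elim: y => [|x y IH] /=; first by rewrite /vol big_nil.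
case/andP=> xN /IH yN; rewrite /vol big_cons mulr_ile1 ?divr_ge0 ?vol_ge0 //.
by rewrite ler_pdivrMr ?ltr0n // mul1r ler_nat.
Qed.

(** Points outside the increment are those below [a] and those not below [b]. *)
Lemma card_avoid l a b : all2 leq a b ->
  (#|[pred n | inbox l a n || ~~ inbox l b n]| + hits l b = hits l a + N)%N.
Proof.
move=> ab.
have E : #|[pred n | inbox l a n || ~~ inbox l b n]| = (hits l a + #|[pred n | ~~ inbox l b n]|)%N.
  rewrite /hits -cardUI [X in (_ + X)%N]eq_card0 ?addn0 => [|n].
    by apply: eq_card => n; rewrite !inE.
  by rewrite !inE; apply/negP => /andP[/(inbox_mono ab) ->].
have C : (hits l b + #|[pred n | ~~ inbox l b n]| = N)%N.
  by rewrite -[X in _ = X](card_ord N) -(cardC [pred n | inbox l b n]).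
by rewrite E -addnA [(_ + hits l b)%N]addnC C.
Qed.

Lemma chernoff_avoid a b (s z : R) : size a = d -> all2 leq a b ->
  all (fun x => x <= N)%N b -> 0 <= s ->
  Pr (fun l => (N%:R * z < #|[pred n | inbox l a n || ~~ inbox l b n]|%:R)%R) <=
  ((1 + (expR s - 1) * (1 - vol R N b + vol R N a)) * expR (- (s * z))) ^+ N.
Proof.
move=> sa ab bN s0; rewrite exprMn [leRHS]mulrC.
apply: le_trans (ler_wpM2l _ (expect_mgf_avoid N0 wnd sa ab bN _)); last 2 first.
- by rewrite exprn_ge0 ?expR_ge0.
- by rewrite -[leLHS]expR0 ler_expR.
rewrite -expectZ; apply: expect_le => [j g|l _]; first by case: (wnd j).
case: ltP => [H|_]; last by rewrite mulr_ge0 ?exprn_ge0 ?expR_ge0.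
rewrite -!expRM_natl -expRD -[leLHS]expR0 ler_expR.
by rewrite mulrN addrC subr_ge0 mulrCA [leRHS]mulrC ler_wpM2l // ltW.
Qed.

Lemma local_discB l a b : all2 leq a b ->
  local_disc l a - local_disc l b =
  #|[pred n | inbox l a n || ~~ inbox l b n]|%:R / N%:R - (1 - vol R N b + vol R N a).
Proof.
move=> ab; have := congr1 (fun n => n%:R : R) (card_avoid l ab).
rewrite !natrD => /(canRL (addrK _)) ->; rewrite /local_disc.
by field; rewrite pnatr_eq0 -lt0n.
Qed.

Let v01 a b : all2 leq a b -> all (fun x => x <= N)%N b -> 0 <= 1 - vol R N b + vol R N a <= 1.
Proof. by move=> /vol_mono ab /vol_le1 b1; have := vol_ge0 a; lra. Qed.

(** A shortfall [> t] of points in the increment from [a] to [b] is an excess in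
    its complement, to which the exponential Markov inequality applies. *)
Lemma chernoff_increment a b (t s e : R) : size a = d -> all2 leq a b ->
  all (fun x => x <= N)%N b -> 0 <= s ->
  (1 + (expR s - 1) * (1 - vol R N b + vol R N a)) <=
    expR (s * (1 - vol R N b + vol R N a) + s * t - e) ->
  Pr (fun l => (t < local_disc l a - local_disc l b)%R) <= expR (- (N%:R * e)).
Proof.
move=> sa ab bN s0 H.
have NR : 0 < N%:R :> R by rewrite ltr0n.
set v := 1 - vol R N b + vol R N a in H *.
apply: (@le_trans _ _ (Pr (fun l =>
    (N%:R * (v + t) < #|[pred n | inbox l a n || ~~ inbox l b n]|%:R)%R))).
  apply: Pr_le => l _; rewrite local_discB // -/v => H1.
  by rewrite mulrC -ltr_pdivlMr //; lra.
apply: le_trans (chernoff_avoid (v + t) sa ab bN s0) _; rewrite -/v.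
rewrite -[in leRHS]mulrN expRM_natl lerXn2r ?nnegrE ?expR_ge0 ?mulr_ge0 ?expR_ge0 //.
  have /andP[v0 _] := v01 ab bN; rewrite -/v in v0.
  have : 1 <= expR s by rewrite -[leLHS]expR0 ler_expR.
  by move=> ?; nra.
apply: le_trans (ler_wpM2r (expR_ge0 _) H) _.
by rewrite -expRD ler_expR; lra.
Qed.

Lemma hoeffding_increment a b (t : R) : size a = d -> all2 leq a b ->
  all (fun x => x <= N)%N b -> 0 <= t ->
  Pr (fun l => (t < local_disc l a - local_disc l b)%R) <= expR (- (N%:R * (2 * t ^+ 2))).
Proof.
move=> sa ab bN t0.
apply: (@chernoff_increment _ _ _ (4 * t)) => //; first by rewrite mulr_ge0.
apply: le_trans (hoeffding_bernoulli (v01 ab bN) _) _; first by rewrite mulr_ge0.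
by rewrite ler_expR; lra.
Qed.

(** The increment holds few points in expectation.  Only its lower tail is
    estimated, so the exponent is controlled by [expR (- s) <= 1 - s + s ^ 2 / 2],
    which holds for every [s >= 0]; hence no restriction on [t]. *)
Lemma small_increment a b (t delta : R) : size a = d -> all2 leq a b ->
  all (fun x => x <= N)%N b -> 0 <= t -> 0 < delta ->
  vol R N b - vol R N a <= delta ->
  Pr (fun l => (t < local_disc l a - local_disc l b)%R) <= expR (- (N%:R * (t ^+ 2 / (2 * delta)))).
Proof.
move=> sa ab bN t0 del0 dv; pose s := t / delta.
have s0 : 0 <= s by rewrite divr_ge0 // ltW.
apply: (@chernoff_increment _ _ _ s) => //.
set q := vol R N b - vol R N a in dv.
have -> : 1 - vol R N b + vol R N a = 1 - q by rewrite /q; ring.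
have q0 : 0 <= q by rewrite subr_ge0 vol_mono.
have -> : 1 + (expR s - 1) * (1 - q) = expR s * (1 - q * (1 - expR (- s))).
  by rewrite expRN; field; rewrite gt_eqF ?expR_gt0.
apply: (@le_trans _ _ (expR s * expR (- (q * (1 - expR (- s)))))).
  by rewrite ler_wpM2l ?expR_ge0 // expR_ge1Dx.
rewrite -expRD ler_expR.
have := expRN_le_quadratic s0; set x := expR (- s) => xs.
have st : s * t - t ^+ 2 / (2 * delta) = delta * s ^+ 2 / 2.
  by rewrite /s; field; rewrite gt_eqF.
rewrite -addrA st.
have H1 : q * x <= q * (1 - s + s ^+ 2 / 2) by rewrite ler_wpM2l.
have H2 : q * s ^+ 2 <= delta * s ^+ 2 by rewrite ler_wpM2r ?sqr_ge0.
lra.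
Qed.

(** A box is the complement of the increment up to the whole cube. *)
Lemma upper_tail b (t : R) : size b = d -> all (fun x => x <= N)%N b -> 0 <= t ->
  Pr (fun l => (t < local_disc l b)%R) <= expR (- (N%:R * (2 * t ^+ 2))).
Proof.
move=> sb bN t0.
have full : all2 leq b (nseq d N).
  by rewrite -sb; elim: b bN {sb} => //= x b IH /andP[-> /IH].
apply: le_trans (hoeffding_increment sb full _ t0); last by rewrite all_nseq leqnn orbT.
apply: Pr_le => l _; suff -> : local_disc l (nseq d N) = 0 by rewrite subr0.
have hitsN : hits l (nseq d N) = N.
  rewrite /hits -[RHS](card_ord N); apply: eq_card => n; rewrite !inE.
  by elim: l (d) => [|g l IH] [|k] //=; rewrite ltn_ord IH.
have NN : N%:R / N%:R = 1 :> R by rewrite mulfV // pnatr_eq0 -lt0n.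
have volN : vol R N (nseq d N) = 1.
  by rewrite /vol; elim: (d) => [|k IH]; rewrite /= ?big_nil // big_cons NN mul1r.
by rewrite /local_disc volN hitsN NN subrr.
Qed.

(** A box is an increment that starts from an empty box. *)
Lemma lower_tail b (t : R) : size b = d -> all (fun x => x <= N)%N b -> 0 <= t ->
  Pr (fun l => (t < - local_disc l b)%R) <= expR (- (N%:R * (2 * t ^+ 2))).
Proof.
move=> sb bN t0.
have empty : all2 leq (nseq d 0%N) b by rewrite -sb; elim: b {bN sb} => //=.
apply: le_trans (hoeffding_increment (size_nseq _ _) empty bN t0).
apply: Pr_le => l sl; suff -> : local_disc l (nseq d 0%N) = 0 by rewrite sub0r.
case: d d0 sl => // k _ /=; case: l => // g l _.
by rewrite /local_disc /hits /vol /= big_cons mul0r mul0r eq_card0 ?mul0r ?subr0.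
Qed.

End Tails.

(** * Chaining through brackets of increasing resolution *)

Section Chaining.
Variables (R : realType) (N d : nat) (w : nat -> column N -> R).
Hypotheses (N0 : (0 < N)%N) (d0 : (0 < d)%N) (wnd : forall j, column_neg_dep (w j)).
Variables (res : nat -> nat) (t : nat -> R).
Hypotheses (res0 : forall k, (0 < res k)%N) (t0 : forall k, 0 <= t k).
Variable B : nat -> seq (seq nat * seq nat).
Hypothesis B_ok : forall k b, b \in B k -> bracket_ok N (d * res k) d b.
Hypothesis B_cover : forall k y, size y = d -> all (fun x => x <= N)%N y ->
  exists2 b, b \in B k & all2 leq b.1 y && all2 leq y b.2.
Implicit Types (l : seq (column N)) (y : seq nat) (b : seq nat * seq nat).

Let grid y := (size y == d) && all (fun x => x <= N)%N y.

Lemma all_le_trans x y : all2 leq x y -> all (fun x => x <= N)%N y ->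
  all (fun x => x <= N)%N x.
Proof.
elim: x y => [|i x IH] [|j y] //= /andP[ij xy] /andP[jN yN].
by rewrite (leq_trans ij jN) (IH _ xy yN).
Qed.

Lemma vol_natE y : vol R N y = (\prod_(x <- y) x)%:R / N%:R ^+ size y.
Proof.
elim: y => [|x y IH]; first by rewrite /vol !big_nil expr0 divr1.
rewrite /vol !big_cons -/(vol R N y) IH natrM exprS invfM; ring.
Qed.

Lemma bracket_okP k b : b \in B k ->
  [/\ grid b.1, grid b.2, all2 leq b.1 b.2
    & vol R N b.2 - vol R N b.1 <= (res k)%:R^-1].
Proof.
move=> /B_ok /and4P[/eqP s1 b12 b2N H].
have s2 : size b.2 = d by rewrite -(all2_size_leq b12).
rewrite /grid s1 s2 eqxx b2N (all_le_trans b12 b2N); split=> //.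
rewrite !vol_natE s1 s2 -mulrBl.
have NR : 0 < N%:R ^+ d :> R by rewrite exprn_gt0 ?ltr0n.
have rR : 0 < (res k)%:R :> R by rewrite ltr0n.
have dR : 0 < d%:R :> R by rewrite ltr0n.
rewrite ler_pdivrMr // ler_pdivlMl //.
rewrite -(ler_pM2l dR) mulrA mulrBr lerBlDl -natrX -!natrM -natrD ler_nat.
by [].
Qed.

(** A bracket of level [k] around [y]; the default of [nth] is never reached for
    [y] in the grid. *)
Definition parent k y :=
  nth ([::], [::]) (B k) (find (fun b => all2 leq b.1 y && all2 leq y b.2) (B k)).

Lemma parentP k y : grid y ->
  [/\ parent k y \in B k, all2 leq (parent k y).1 y & all2 leq y (parent k y).2].
Proof.
case/andP=> /eqP sy yN; have [b bB bP] := B_cover k sy yN.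
have hasB : has (fun b => all2 leq b.1 y && all2 leq y b.2) (B k).
  by apply/hasP; exists b.
by have := nth_find ([::], [::]) hasB => /andP[]; split=> //; rewrite mem_nth -?has_find.
Qed.

(** At level 0 the brackets themselves deviate; at a later level there is a
    shortfall in an increment between the corner of a bracket and its parent. *)
Definition bad_level k l : bool :=
  if k is k'.+1 then
    has (fun b => (t k < local_disc R l b.2 - local_disc R l (parent k' b.2).2)
               || (t k < local_disc R l (parent k' b.1).1 - local_disc R l b.1)) (B k)
  else has (fun b => (t 0%N < local_disc R l b.2) || (t 0%N < - local_disc R l b.1)) (B 0%N).

(** Upper corners inherit the excess of larger boxes, lower corners the lack of
    points of smaller boxes. *)
Lemma chain_disc K l : (forall k, (k <= K)%N -> ~~ bad_level k l) ->
  forall b, b \in B K ->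
  local_disc R l b.2 <= \sum_(k < K.+1) t k /\ - local_disc R l b.1 <= \sum_(k < K.+1) t k.
Proof.
elim: K => [|K IH] good b bB.
  rewrite big_ord1; have := good 0%N isT; rewrite /= -all_predC => /allP /(_ _ bB) /=.
  by rewrite negb_or -!leNgt => /andP[].
have {}IH := IH (fun k kK => good k (leqW kK)).
have := good K.+1 (leqnn _); rewrite /= -all_predC => /allP /(_ _ bB) /=.
rewrite negb_or -!leNgt => /andP[H1 H2].
have [g1 g2 _ _] := bracket_okP bB.
have [p1 _ _] := parentP K g1; have [p2 _ _] := parentP K g2.
have [_ I1] := IH _ p1; have [I2 _] := IH _ p2.
rewrite [\sum_(k < K.+2) _]big_ord_recr /=; split; lra.
Qed.

Lemma good_disc K l : (forall k, (k <= K)%N -> ~~ bad_level k l) ->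
  forall y, grid y -> `|local_disc R l y| <= \sum_(k < K.+1) t k + (res K)%:R^-1.
Proof.
move=> good y gy; have [pB p1 p2] := parentP K gy.
have [u1 u2] := chain_disc good pB; have [_ _ _ vv] := bracket_okP pB.
set b := parent K y in pB p1 p2 u1 u2 vv.
have NR : 0 < N%:R :> R by rewrite ltr0n.
have h1 : (hits l b.1)%:R / N%:R <= (hits l y)%:R / N%:R :> R.
  by rewrite ler_pM2r ?invr_gt0 // ler_nat hits_mono.
have h2 : (hits l y)%:R / N%:R <= (hits l b.2)%:R / N%:R :> R.
  by rewrite ler_pM2r ?invr_gt0 // ler_nat hits_mono.
have v1 := vol_mono R N p1; have v2 := vol_mono R N p2.
by rewrite ler_norml; move: u1 u2; rewrite /local_disc; lra.
Qed.

Lemma Pr_bad0 : Pr d w (bad_level 0) <=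
  2 * (size (B 0%N))%:R * expR (- (N%:R * (2 * t 0%N ^+ 2))).
Proof.
rewrite [2 * _]mulrC -mulrA; apply: (Pr_has wnd) => b bB.
have [/andP[/eqP s1 b1] /andP[/eqP s2 b2] _ _] := bracket_okP bB.
apply: le_trans (Pr_or d wnd _ _) _.
by rewrite mulr_natl mulr2n lerD // ?upper_tail ?lower_tail.
Qed.

Lemma Pr_badS k : Pr d w (bad_level k.+1) <=
  2 * (size (B k.+1))%:R * expR (- (N%:R * (t k.+1 ^+ 2 / (2 * (res k)%:R^-1)))).
Proof.
rewrite [2 * _]mulrC -mulrA; apply: (Pr_has wnd) => b bB.
have [g1 g2 _ _] := bracket_okP bB.
have [/andP[/eqP s1 b1] /andP[/eqP s2 b2]] := (g1, g2).
have [p1B p1 q1] := parentP k g1; have [p2B q2 p2] := parentP k g2.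
have [/andP[/eqP sp1 bp1] _ _ v1] := bracket_okP p1B.
have [_ /andP[/eqP sp2 bp2] _ v2] := bracket_okP p2B.
have rR : 0 < (res k)%:R^-1 :> R by rewrite invr_gt0 ltr0n.
apply: le_trans (Pr_or d wnd _ _) _; rewrite mulr_natl mulr2n lerD //.
  apply: (small_increment N0 wnd) => //.
  apply: le_trans v2; rewrite lerD2l lerN2; exact: vol_mono.
apply: (small_increment N0 wnd) => //.
apply: le_trans v1; rewrite lerD2r; exact: vol_mono.
Qed.

Lemma Pr_bad K (e : nat -> R) : (forall k, (k <= K)%N -> Pr d w (bad_level k) <= e k) ->
  Pr d w (fun l => has (bad_level^~ l) (iota 0 K.+1)) <= \sum_(k < K.+1) e k.
Proof.
elim: K => [|K IH] He.
  rewrite big_ord1; apply: le_trans (He 0%N isT).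
  by apply: Pr_le => // l _ /=; rewrite orbF.
rewrite big_ord_recr [leRHS]/=.
apply: le_trans (lerD (IH (fun k kK => He k (leqW kK))) (He K.+1 (leqnn _))).
apply: le_trans (Pr_or d wnd _ _); apply: Pr_le => // l _.
by rewrite -[K.+2]addn1 iotaD has_cat /= orbF.
Qed.

End Chaining.

(** * Choice of the resolutions and of the deviations *)

Section FineLevels.
Variable R : realType.

Definition fine_res k := (2 ^ (12 + 4 * k))%N.

Lemma fine_res_succ k : (fine_res k.+1).+1%:R <= 16 * (fine_res k).+1%:R :> R.
Proof.
rewrite /fine_res -natrM ler_nat [(4 * k.+1)%N]mulnS addnCA expnD.
by set z := (2 ^ (12 + _))%N; rewrite (_ : 2 ^ 4 = 16)%N // mulnS -[leqLHS]addn1 addnC leq_add2r.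
Qed.

Lemma expRN32_le : expR (- 2 ^+ 5) <= (10 / 27) ^+ 32 :> R.
Proof.
have -> : - 2 ^+ 5 = 32%:R * (- 1) :> R by rewrite mulrN mulr1 -natrX.
rewrite expRM_natl expRN lerXn2r ?nnegrE ?invr_ge0 ?expR_ge0 ?divr_ge0 //.
by rewrite -[leLHS]div1r ler_pdivrMr ?expR_gt0 //; have := @expR1_ge R; lra.
Qed.

(** From one level to the next the resolution grows by a factor 16, while the
    exponential factor is raised to the fourth power. *)
Lemma fine_level_weight k :
  2 * (fine_res k.+1).+1%:R * expR (- 2 ^+ (5 + 2 * k)) <= (1 / 10 ^+ 8) / 2 ^+ k.+1 :> R.
Proof.
elim: k => [|k IH].
  rewrite /fine_res muln0 addn0 expr1.
  have -> : (2 ^ (12 + 4 * 1)).+1%:R = 2 ^+ 16 + 1 :> R by rewrite -natr1 natrX.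
  by have := expRN32_le; move: (expR _) => E; lra.
have -> : 2 ^+ (5 + 2 * k.+1) = 4%:R * 2 ^+ (5 + 2 * k) :> R.
  by rewrite mulnS addnCA [LHS]exprD -natrX.
rewrite -mulrN expRM_natl.
have xk : 32 <= 2 ^+ (5 + 2 * k) :> R.
  by rewrite -natrX ler_nat expnD leq_pmulr // expn_gt0.
have E1 : expR (- 2 ^+ (5 + 2 * k)) <= 1 / 33 :> R.
  rewrite expRN -[leLHS]div1r ler_pdivrMr ?expR_gt0 //.
  by have := expR_ge1Dx (2 ^+ (5 + 2 * k) : R); lra.
move: IH E1 (expR_ge0 (- 2 ^+ (5 + 2 * k) : R)) (fine_res_succ k.+1).
move: {xk} (expR _) => E IH E1 E0 rS.
have r0 : 0 <= (fine_res k.+1).+1%:R :> R by [].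
have E4 : E ^+ 4 <= E * (1 / 33) ^+ 3.
  by rewrite exprS ler_wpM2l // lerXn2r ?nnegrE ?divr_ge0.
apply: (@le_trans _ _ ((2 * (fine_res k.+1).+1%:R * E) / 2)); last first.
  have -> : (1 / 10 ^+ 8) / 2 ^+ k.+2 = ((1 / 10 ^+ 8) / 2 ^+ k.+1) / 2 :> R.
    by rewrite [2 ^+ k.+2]exprS [(2 * _)^-1]invfM [2^-1 * _]mulrC mulrA.
  by rewrite ler_wpM2r.
apply: (@le_trans _ _ (2 * (16 * (fine_res k.+1).+1%:R) * (E * (1 / 33) ^+ 3))).
  by rewrite ler_pM ?mulr_ge0 ?exprn_ge0 // ler_wpM2l.
have : 0 <= (fine_res k.+1).+1%:R * E by rewrite mulr_ge0.
lra.
Qed.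

Lemma geometric_half_sum K : \sum_(k < K) (1 / 2 ^+ k.+1 : R) = 1 - 1 / 2 ^+ K.
Proof.
elim: K => [|K IH]; first by rewrite big_ord0 expr0 divr1 subrr.
by rewrite big_ord_recr /= IH exprS; field; rewrite expf_neq0.
Qed.

End FineLevels.

Section GridBound.
Variables (R : realType) (N d : nat) (w : nat -> column N -> R).
Hypotheses (N0 : (0 < N)%N) (d0 : (0 < d)%N) (wnd : forall j, column_neg_dep (w j)).

Definition grid_disc_le (theta : R) (l : seq (column N)) : bool :=
  [forall y : d.-tuple 'I_N.+1, `|local_disc R l [seq val x | x <- y]| <= theta].

(** Under the smallness condition on [x], every further dimension multiplies the
    union bound by a factor at most 1, so that [d = 1] is the worst case. *)
Lemma level_count s n (x : R) : (s <= 'C(d * n + d, d))%N ->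
  expR 1 * n.+1%:R * expR (- x) <= 1 ->
  2 * s%:R * expR (- (d%:R * x)) <= 2 * n.+1%:R * expR (- x).
Proof.
case: d d0 => // k _ sC E1.
rewrite -!mulrA ler_wpM2l // -mulrN expRM_natl exprS.
apply: (@le_trans _ _ (expR 1 ^+ k * n.+1%:R ^+ k.+1 * (expR (- x) * expR (- x) ^+ k))).
  rewrite ler_wpM2r ?mulr_ge0 ?exprn_ge0 ?expR_ge0 //.
  by apply: le_trans (bin_le_expR _ k n); rewrite ler_nat.
rewrite [n.+1%:R ^+ _]exprS.
have -> : expR 1 ^+ k * (n.+1%:R * n.+1%:R ^+ k) * (expR (- x) * expR (- x) ^+ k) =
  n.+1%:R * expR (- x) * (expR 1 * n.+1%:R * expR (- x)) ^+ k by rewrite !exprMn; ring.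
rewrite -[leRHS]mulr1 ler_wpM2l ?mulr_ge0 ?expR_ge0 // exprn_ile1 //.
Qed.

Lemma Pr_not_grid_disc_le (res : nat -> nat) (t x : nat -> R) K (theta : R) :
  (forall k, (0 < res k)%N) -> (forall k, 0 <= t k) ->
  N%:R * (2 * t 0%N ^+ 2) = d%:R * x 0%N ->
  (forall k, N%:R * (t k.+1 ^+ 2 * (res k)%:R / 2) = d%:R * x k.+1) ->
  (forall k, (k <= K)%N -> expR 1 * (res k).+1%:R * expR (- x k) <= 1) ->
  \sum_(k < K.+1) t k + (res K)%:R^-1 <= theta ->
  Pr d w (fun l => ~~ grid_disc_le theta l) <=
  \sum_(k < K.+1) 2 * (res k).+1%:R * expR (- x k).
Proof.
move=> res0 t0 x0 xS small sum_le.
have /choice[B HB] : forall k, exists B : seq (seq nat * seq nat),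
   [/\ (size B <= 'C(d * res k + d, d))%N,
      forall b, b \in B -> bracket_ok N (d * res k) d b
    & forall y, size y = d -> all (fun x => x <= N)%N y ->
        exists2 b, b \in B & all2 leq b.1 y && all2 leq y b.2].
  by move=> k; apply: bracketing_cover.
have B_ok k b : b \in B k -> bracket_ok N (d * res k) d b.
  by case: (HB k) => _ + _; apply.
have B_cover k y : size y = d -> all (fun x => x <= N)%N y ->
    exists2 b, b \in B k & all2 leq b.1 y && all2 leq y b.2.
  by case: (HB k) => _ _; apply.
have Bs k : (size (B k) <= 'C(d * res k + d, d))%N by case: (HB k).
apply: (@le_trans _ _ (Pr d w (fun l => has ((bad_level t B)^~ l) (iota 0 K.+1)))).
  apply: Pr_le => // l _; apply: contraR => /hasPn good.
  have {}good k : (k <= K)%N -> ~~ bad_level t B k l.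
    by move=> kK; apply: good; rewrite mem_iota add0n ltnS.
  apply/forallP => y; apply: le_trans sum_le.
  apply: (good_disc N0 d0 res0 B_ok B_cover good).
  rewrite size_map size_tuple eqxx /=; apply/allP => _ /mapP[i _ ->].
  by rewrite -ltnS ltn_ord.
apply: (Pr_bad wnd (e := fun k => 2 * (res k).+1%:R * expR (- x k))) => -[|k] kK.
  apply: le_trans (Pr_bad0 N0 d0 wnd res0 t0 B_ok) _.
  by rewrite x0; apply: level_count (Bs 0%N) (small _ kK).
apply: le_trans (Pr_badS N0 d0 wnd res0 t0 B_ok B_cover k) _.
have -> : t k.+1 ^+ 2 / (2 * (res k)%:R^-1) = t k.+1 ^+ 2 * (res k)%:R / 2.
  by rewrite invfM invrK; ring.
rewrite xS.
exact: level_count (Bs _) (small _ kK).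
Qed.

Let rho : R := Num.sqrt (d%:R / N%:R).

Let rho_gt0 : 0 < rho.
Proof. by rewrite sqrtr_gt0 divr_gt0 ?ltr0n. Qed.

Let N_rho2 : N%:R * rho ^+ 2 = d%:R.
Proof.
rewrite sqr_sqrtr ?divr_ge0 // mulrC divfK // pnatr_eq0 -lt0n //.
Qed.

(** One level with resolution [2 ^ 8]: the deviation [(c - 41 / 100) * rho] leaves
    [41 / 100 * rho] for the volume gap [1 / 256] and the rounding [rho ^ 2]. *)
Lemma Pr_coarse (c : R) : 5 / 2 <= c -> c * rho <= 1 -> 1 / 100 <= rho ->
  expR 1 * (2 ^+ 8 + 1) * expR (- (2 * (c - 41 / 100) ^+ 2)) <= 1 ->
  Pr d w (fun l => ~~ grid_disc_le (c * rho - rho ^+ 2) l) <=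
  2 * (2 ^+ 8 + 1) * expR (- (2 * (c - 41 / 100) ^+ 2)).
Proof.
move=> c1 crho rho1 small.
have rho2 : rho <= 2 / 5.
  have := ler_wpM2r (ltW rho_gt0) c1; lra.
pose t k : R := if k is 0%N then (c - 41 / 100) * rho else 0.
pose x k : R := if k is 0%N then 2 * (c - 41 / 100) ^+ 2 else 0.
have res1 : (2 ^ 8).+1%:R = 2 ^+ 8 + 1 :> R by rewrite -natr1 natrX.
have := @Pr_not_grid_disc_le (fun=> (2 ^ 8)%N) t x 0 (c * rho - rho ^+ 2).
rewrite !big_ord1 /= res1 natrX /t /x => H; apply: le_trans (H _ _ _ _ _ _) _; clear H.
- by move=> _; rewrite expn_gt0.
- by case=> [|k]; rewrite ?mulr_ge0 ?(ltW rho_gt0) // subr_ge0; lra.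
- by rewrite -N_rho2 exprMn; ring.
- by move=> k; rewrite expr0n /= !mul0r !mulr0.
- by case=> [_|//]; exact: small.
(* by convexity, rho + 1 / (256 rho) <= 41 / 100 between the ends 1 / 100 and 2 / 5 *)
- have : (rho - 1 / 100) * (rho - 2 / 5) <= 0.
    by rewrite mulr_ge0_le0 // ?subr_ge0 ?subr_le0.
  lra.
- by [].
Qed.

(** Here [3 / 10 * rho] is left by the first level: [rho / 4] for the later
    levels, [rho / 25] for the finest volume gap, and [rho / 100] for the rounding
    [rho ^ 2]. *)
Lemma Pr_fine (c : R) : 3 / 10 <= c -> rho <= 1 / 100 ->
  expR 1 * (2 ^+ 12 + 1) * expR (- (2 * (c - 3 / 10) ^+ 2)) <= 1 ->
  Pr d w (fun l => ~~ grid_disc_le (c * rho - rho ^+ 2) l) <=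
  2 * (2 ^+ 12 + 1) * expR (- (2 * (c - 3 / 10) ^+ 2)) + 1 / 10 ^+ 8.
Proof.
move=> c1 rho1 small.
pose res := fine_res.
pose t k : R := if k is k'.+1 then rho / 2 ^+ (k' + 3) else (c - 3 / 10) * rho.
pose x k : R := if k is k'.+1 then 2 ^+ (5 + 2 * k') else 2 * (c - 3 / 10) ^+ 2.
have [K HK] : exists K : nat, 25 / rho <= (res K)%:R.
  have [K HK] : exists K : nat, 25 / rho <= K%:R.
    exists (Num.bound (25 / rho)); apply: le_trans (ltW (archi_boundP _)) => //.
    by rewrite divr_ge0 // ltW.
  exists K; apply: le_trans HK _; rewrite ler_nat /res /fine_res ltnW //.
  by rewrite (leq_trans (ltn_expl K (isT : 1 < 2)%N)) // leq_exp2l //; lia.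
have pow_gt0 k : 0 < 2 ^+ k :> R by rewrite exprn_gt0.
apply: (@le_trans _ _ (\sum_(k < K.+1) 2 * (res k).+1%:R * expR (- x k))).
  apply: (@Pr_not_grid_disc_le res t x) => //.
  - by move=> k; rewrite /res /fine_res expn_gt0.
  - by case=> [|k]; rewrite ?divr_ge0 ?mulr_ge0 ?(ltW rho_gt0) ?(ltW (pow_gt0 _)) ?subr_ge0.
  - by rewrite /t /x -N_rho2 exprMn; ring.
  - move=> k; rewrite /t /x /res /fine_res -N_rho2 natrX.
    rewrite !exprD expr0; field.
    by rewrite !expf_neq0.
  - case=> [|k] kK; first by rewrite -natr1 /res /fine_res muln0 addn0 natrX.
    apply: (@le_trans _ _ (3 * ((1 / 10 ^+ 8) / 2 ^+ k.+1))).
      apply: (@le_trans _ _ (3 * (2 * (res k.+1).+1%:R * expR (- x k.+1)))); last first.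
        by rewrite ler_wpM2l // fine_level_weight.
      have : 0 <= (res k.+1).+1%:R * expR (- x k.+1) by rewrite mulr_ge0 ?expR_ge0.
      have := @expR1_le R; rewrite -mulrA => e3 r0.
      by have := ler_wpM2r r0 e3; lra.
    have : (2 ^+ k.+1)^-1 <= 1 :> R by rewrite invf_le1 // exprn_ege1 // ler1n.
    lra.
  - rewrite big_ord_recl /=.
    have -> : \sum_(i < K) t (bump 0 i) = rho / 4 * \sum_(i < K) (1 / 2 ^+ i.+1).
      rewrite mulr_sumr; apply: eq_bigr => i _.
      by rewrite /t /bump add1n addn3 !exprS; field; rewrite expf_neq0.
    rewrite geometric_half_sum.
    have rK : (res K)%:R^-1 <= rho / 25.
      rewrite -[leRHS]invrK lef_pV2 ?posrE ?invr_gt0 ?divr_gt0 ?invf_div //.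
      by rewrite ltr0n expn_gt0.
    have : 0 <= rho / 4 * (1 / 2 ^+ K) by rewrite mulr_ge0 ?divr_ge0 ?ltW.
    have : rho ^+ 2 <= rho * (1 / 100) by rewrite expr2 ler_wpM2l // ltW.
    lra.
rewrite big_ord_recl lerD //.
  by rewrite [nat_of_ord _]/= -[(res 0).+1%:R]natr1 /res /fine_res muln0 addn0 natrX.
apply: (@le_trans _ _ (\sum_(i < K) (1 / 10 ^+ 8) * (1 / 2 ^+ i.+1))).
  apply: ler_sum => i _; rewrite mulrA mulr1 [nat_of_ord _]/= /bump add1n.
  exact: fine_level_weight.
rewrite -mulr_sumr geometric_half_sum.
have : 0 <= (1 / 10 ^+ 8) * (1 / 2 ^+ K) :> R by rewrite mulr_ge0 ?divr_ge0 ?exprn_ge0.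
lra.
Qed.

End GridBound.

Local Open Scope classical_set_scope.
Local Open Scope ring_scope.

(** * Lebesgue measure of boxes *)

Section Boxes.
Variable R : realType.

Lemma lebesgue_tuple0 d : @lebesgue_tuple R d set0 = 0%E.
Proof.
elim: d => [|d IH] /=; first by rewrite diracE in_set0.
rewrite /pushforward preimage_set0 /product_measure1.
by under eq_integral do rewrite /= xsection0 IH; rewrite integral0.
Qed.

Lemma box_cons d (x0 y0 a : R) (x y t : d.-tuple R) :
  box [tuple of x0 :: x] [tuple of y0 :: y] [tuple of a :: t] <->
  x0 <= a < y0 /\ box x y t.
Proof.
split=> [H|[H1 H2] j]; first split.
- by have := H ord0; rewrite !tnth0.
- by move=> j; have := H (lift ord0 j); rewrite !tnthS.
- by case: (unliftP ord0 j) => [k ->|->]; rewrite ?tnthS ?tnth0.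
Qed.

Lemma lebesgue_tuple_box d (x y : d.-tuple R) : (forall j, tnth x j <= tnth y j) ->
  lebesgue_tuple (box x y) = (\prod_(j < d) (tnth y j - tnth x j))%:E.
Proof.
elim: d x y => [|d IH] x y.
  move=> _; rewrite big_ord0 /= diracE mem_set //; by case.
case/tupleP: x => x0 x; case/tupleP: y => y0 y xy.
have x0y0 : x0 <= y0 by have := xy ord0; rewrite !tnth0.
have {}xy j : tnth x j <= tnth y j by have := xy (lift ord0 j); rewrite !tnthS.
pose V := \prod_(j < d) (tnth y j - tnth x j).
have V0 : 0 <= V by apply: prodr_ge0 => j _; rewrite subr_ge0.
rewrite /= /pushforward /product_measure1 /=.
transitivity (\int[lebesgue_measure]_a (V * \1_(`[x0, y0[) a)%:E)%E.
  apply: eq_integral => a _ /=.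
  have [aI|aI] := boolP (x0 <= a < y0).
  - rewrite indicE mem_set ?mulr1 /= ?in_itv //.
    rewrite [X in lebesgue_tuple X](_ : _ = box x y) ?IH //.
    rewrite predeqE => t; rewrite /xsection /= inE /=.
    by split=> [/box_cons[]|bt] //; apply/box_cons.
  - rewrite indicE memNset ?mulr0 /= ?in_itv /=; last exact/negP.
    rewrite [X in lebesgue_tuple X](_ : _ = set0) ?lebesgue_tuple0 //.
    rewrite predeqE => t; rewrite /xsection /= inE /=; split=> // /box_cons[].
    by rewrite (negbTE aI).
under eq_integral do rewrite EFinM.
rewrite ge0_integralZl //; last by apply/measurable_EFinP; exact: measurable_indic.
rewrite integral_indic // setIT.
transitivity (V%:E * (y0 - x0)%:E)%E; last first.
  rewrite -EFinM mulrC big_ord_recl !tnth0; congr (_ * _)%:E.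
  by apply: eq_bigr => j _; rewrite !tnthS.
congr (_ * _)%E; apply: etrans (lebesgue_measure_itv _) _; rewrite /= lte_fin.
case: ltP => [_|yx]; first by rewrite -EFinB.
by congr (_%:E); apply/esym/eqP; rewrite subr_eq0 eq_le yx x0y0.
Qed.

End Boxes.

(** * Reduction of the star discrepancy to the grid *)

Section StarDiscrepancy.
Variable R : realType.
Implicit Types d N M : nat.

Lemma prodr_le1 d (F : 'I_d -> R) : (forall j, 0 <= F j <= 1) -> 0 <= \prod_j F j <= 1.
Proof.
move=> F01; rewrite prodr_ge0 => [|j _]; last by case/andP: (F01 j).
by rewrite prodr_ile1 // => j _.
Qed.

(** Change the factors one after the other. *)
Lemma prod_diff_le d (F G : 'I_d -> R) (e : R) :
  (forall j, 0 <= F j <= 1) -> (forall j, 0 <= G j <= 1) -> (forall j, G j - F j <= e) ->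
  0 <= e -> \prod_j G j - \prod_j F j <= d%:R * e.
Proof.
move=> + + + e0; elim: d F G => [|d IH] F G F01 G01 FG.
  by rewrite !big_ord0 subrr mul0r.
rewrite !big_ord_recl.
have := IH _ _ (fun j => F01 (lift ord0 j)) (fun j => G01 (lift ord0 j))
  (fun j => FG (lift ord0 j)).
have := prodr_le1 (fun j => F01 (lift ord0 j)).
have := prodr_le1 (fun j => G01 (lift ord0 j)).
set g := \prod_(i < d) G _; set f := \prod_(i < d) F _.
move=> /andP[g0 g1] /andP[f0 f1] H.
have /andP[a0 a1] := F01 ord0; have := FG ord0.
rewrite -natr1 mulrDl mul1r => GF.
have : (G ord0 - F ord0) * g <= e.
  have [neg|pos] := leP (G ord0 - F ord0) 0; first by apply: le_trans e0; rewrite mulr_le0_ge0.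
  by apply: le_trans GF; rewrite ler_piMr // ltW.
have : F ord0 * (g - f) <= d%:R * e.
  have [neg|pos] := leP (g - f) 0.
    by apply: (@le_trans _ _ 0); rewrite ?mulr_ge0_le0 ?mulr_ge0.
  by apply: le_trans H; rewrite ler_piMl // ltW.
lra.
Qed.

Definition corner M d (y : d.-tuple 'I_M.+1) : d.-tuple R :=
  [tuple (tnth y j)%:R / M%:R | j < d].

Lemma volume_box d (z : d.-tuple R) : (forall j, 0 <= tnth z j) ->
  fine (lebesgue_tuple (box (zero_tuple d) z)) = \prod_j tnth z j.
Proof.
move=> z0; rewrite lebesgue_tuple_box => [|j]; last by rewrite tnth_mktuple.
by rewrite /=; apply: eq_bigr => j _; rewrite tnth_mktuple subr0.
Qed.

Lemma closed_cube_corner M d (y : d.-tuple 'I_M.+1) : (0 < M)%N -> closed_unit_cube (corner y).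
Proof.
move=> M0 j; rewrite tnth_mktuple divr_ge0 //= ler_pdivrMr ?ltr0n //.
by rewrite mul1r ler_nat -ltnS.
Qed.

Lemma discrepancy_le1 N d (p : 'I_N -> d.-tuple R) z : closed_unit_cube z ->
  discrepancy p (box (zero_tuple d) z) <= 1.
Proof.
move=> z01; rewrite /discrepancy volume_box => [|j]; last by case/andP: (z01 j).
have /andP[v0 v1] := prodr_le1 z01.
set k := #|_|; have kN : (k <= N)%N by rewrite -[leqRHS]card_ord max_card.
have c0 : 0 <= N%:R^-1 * k%:R :> R by rewrite mulr_ge0 ?invr_ge0.
have c1 : N%:R^-1 * k%:R <= 1 :> R.
  have [N0|N0] := posnP N; first by rewrite N0 invr0 mul0r.
  by rewrite ler_pdivrMl ?ltr0n // mulr1 ler_nat.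
by rewrite ler_norml; lra.
Qed.

Lemma star_discrepancy_le N d (p : 'I_N -> d.-tuple R) (t : R) :
  (forall z, closed_unit_cube z -> discrepancy p (box (zero_tuple d) z) <= t) ->
  star_discrepancy p <= t.
Proof.
move=> H; apply: ge_sup.
  exists (discrepancy p (box (zero_tuple d) (zero_tuple d))), (zero_tuple d) => //.
  by move=> j; rewrite tnth_mktuple lexx ler01.
by move=> _ [z zc <-]; apply: H.
Qed.

Lemma discrepancy_le_star N d (p : 'I_N -> d.-tuple R) z : closed_unit_cube z ->
  discrepancy p (box (zero_tuple d) z) <= star_discrepancy p.
Proof.
move=> zc; apply: ub_le_sup; last by exists z.
by exists 1 => _ [y yc <-]; apply: discrepancy_le1.
Qed.

Lemma star_discrepancy_ge0 N d (p : 'I_N -> d.-tuple R) : 0 <= star_discrepancy p.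
Proof.
have zc : closed_unit_cube (@zero_tuple R d) by move=> j; rewrite tnth_mktuple lexx ler01.
by apply: le_trans (discrepancy_le_star p zc); exact: normr_ge0.
Qed.

(** Compare a box with the grid boxes obtained by rounding its corner down and
    up: the counts are monotone, and the volumes change by at most [d / M]. *)
Lemma discrepancy_le_corners N d (p : 'I_N -> d.-tuple R) M (t : R) : (0 < M)%N ->
  (forall y : d.-tuple 'I_M.+1, discrepancy p (box (zero_tuple d) (corner y)) <= t) ->
  forall z, closed_unit_cube z ->
  discrepancy p (box (zero_tuple d) z) <= t + d%:R / M%:R.
Proof.
move=> M0 H z zc.
have MR : 0 < M%:R :> R by rewrite ltr0n.
pose m j := Num.truncn (M%:R * tnth z j).
have mP j : (m j)%:R <= M%:R * tnth z j < (m j).+1%:R.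
  by apply: truncn_itv; rewrite mulr_ge0 //; case/andP: (zc j).
have mM j : (m j <= M)%N.
  rewrite -(ler_nat R); case/andP: (mP j) => /le_trans + _; apply.
  by rewrite ler_piMr //; case/andP: (zc j).
pose lo : d.-tuple 'I_M.+1 := [tuple inord (m j) | j < d].
pose up : d.-tuple 'I_M.+1 := [tuple inord (minn M (m j).+1) | j < d].
have loE j : tnth (corner lo) j = (m j)%:R / M%:R.
  by rewrite !tnth_mktuple inordK // ltnS.
have upE j : tnth (corner up) j = (minn M (m j).+1)%:R / M%:R.
  by rewrite !tnth_mktuple inordK // ltnS geq_minl.
have lo_z j : tnth (corner lo) j <= tnth z j.
  by rewrite loE ler_pdivrMr // mulrC; case/andP: (mP j).
have z_up j : tnth z j <= tnth (corner up) j.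
  rewrite upE ler_pdivlMr // mulrC /minn; case: ifP => _.
    by rewrite ler_piMr //; case/andP: (zc j).
  by apply: ltW; case/andP: (mP j).
have loc := closed_cube_corner lo M0; have upc := closed_cube_corner up M0.
have cnt (x y : d.-tuple R) : (forall j, tnth x j <= tnth y j) ->
    N%:R^-1 * #|[pred n | p n \in box (zero_tuple d) x]|%:R <=
    N%:R^-1 * #|[pred n | p n \in box (zero_tuple d) y]|%:R :> R.
  move=> xy; rewrite ler_wpM2l ?invr_ge0 // ler_nat subset_leq_card //.
  apply/fintype.subsetP => n; rewrite !inE => px j.
  by case/andP: (px j) => -> /= /lt_le_trans; apply.
have := H lo; have := H up; have := cnt _ _ lo_z; have := cnt _ _ z_up.
rewrite /discrepancy !volume_box; last 3 first.
- by move=> j; case/andP: (zc j).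
- by move=> j; case/andP: (loc j).
- by move=> j; case/andP: (upc j).
have vz : \prod_j tnth z j - \prod_j tnth (corner lo) j <= d%:R / M%:R.
  apply: (prod_diff_le loc zc) => [j|]; last by rewrite invr_ge0.
  rewrite loE lerBlDl -[X in _ + X]mul1r -mulrDl natr1 ler_pdivlMr // mulrC.
  by apply: ltW; case/andP: (mP j).
have vu : \prod_j tnth (corner up) j - \prod_j tnth z j <= d%:R / M%:R.
  apply: (prod_diff_le zc upc) => [j|]; last by rewrite invr_ge0.
  rewrite upE lerBlDl; apply: (@le_trans _ _ ((m j).+1%:R / M%:R)).
    by rewrite ler_pM2r ?invr_gt0 // ler_nat geq_minr.
  rewrite -natr1 mulrDl mul1r lerD2r ler_pdivrMr // mulrC.
  by case/andP: (mP j).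
by rewrite !ler_norml => h1 h2 /andP[h3 h4] /andP[h5 h6]; lra.
Qed.

(** The supremum is controlled by countably many boxes.  This makes the events in
    the theorem measurable. *)
Lemma star_discrepancy_leP N d (p : 'I_N -> d.-tuple R) (t : R) :
  star_discrepancy p <= t <->
  forall M (y : d.-tuple 'I_M.+2), discrepancy p (box (zero_tuple d) (corner y)) <= t.
Proof.
split=> [H M y|H].
  by apply: le_trans H; apply/discrepancy_le_star/closed_cube_corner.
apply: star_discrepancy_le => z zc; apply/ler_addgt0Pr => e e0.
have [M HM] : exists M : nat, d%:R / e <= M%:R.
  by exists (Num.bound (d%:R / e)); apply/ltW/archi_boundP; rewrite divr_ge0 // ltW.
apply: le_trans (discrepancy_le_corners (ltn0Sn M) (H M) zc) _.
rewrite lerD2l ler_pdivrMr ?ltr0n // mulrC -ler_pdivrMr //.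
by apply: le_trans HM _; rewrite ler_nat.
Qed.

Definition in_cell N d (p : 'I_N -> d.-tuple R) (C : d.-tuple (column N)) :=
  forall n j, (tnth C j n)%:R <= N%:R * tnth (p n) j < (tnth C j n).+1%:R.

Lemma inboxE N d (C : d.-tuple (column N)) (y : d.-tuple 'I_N.+1) n :
  inbox C [seq val x | x <- y] n = [forall j, (tnth C j n < tnth y j)%N].
Proof.
elim: d C y => [|d IH] C y.
  by rewrite (tuple0 C) /=; apply/esym/forallP; case.
case/tupleP: C => g C; case/tupleP: y => x y /=.
rewrite IH; apply/andP/forallP => [[gx /forallP H] j|H].
  by case: (unliftP ord0 j) => [k ->|->]; rewrite ?tnthS ?tnth0.
split; first by have := H ord0; rewrite !tnth0.
by apply/forallP => j; have := H (lift ord0 j); rewrite !tnthS.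
Qed.

Lemma discrepancy_corner N d (p : 'I_N -> d.-tuple R) (C : d.-tuple (column N))
    (y : d.-tuple 'I_N.+1) : (0 < N)%N -> in_cell p C ->
  discrepancy p (box (zero_tuple d) (corner y)) = `|local_disc R C [seq val x | x <- y]|.
Proof.
move=> N0 pC; rewrite /discrepancy /local_disc volume_box; last first.
  by move=> j; case/andP: (closed_cube_corner y N0 j).
have NR : 0 < N%:R :> R by rewrite ltr0n.
rewrite mulrC; congr `| _ / _ - _ |.
  congr (_%:R); apply: eq_card => n; rewrite !inE inboxE.
  apply/asboolP/forallP => H j; have := H j; have /andP[c1 c2] := pC n j.
    rewrite !tnth_mktuple ltr_pdivlMr // mulrC => /andP[_ /(le_lt_trans c1)].
    by rewrite ltr_nat.
  rewrite !tnth_mktuple ltr_pdivlMr // mulrC => cy; apply/andP; split.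
    by rewrite -(pmulr_rge0 _ NR); apply: le_trans c1.
  by apply: lt_le_trans c2 _; rewrite ler_nat.
rewrite /vol big_map big_tuple; apply: eq_bigr => j _.
by rewrite tnth_mktuple.
Qed.

Lemma star_discrepancy_le_grid N d (p : 'I_N -> d.-tuple R) (C : d.-tuple (column N)) (t : R) :
  (0 < N)%N -> in_cell p C -> grid_disc_le d t C ->
  star_discrepancy p <= t + d%:R / N%:R.
Proof.
move=> N0 pC /forallP good; apply: star_discrepancy_le.
by apply: discrepancy_le_corners => // y; rewrite (discrepancy_corner _ N0 pC).
Qed.

Lemma measurable_box d (x y : d.-tuple R) : measurable (box x y).
Proof.
rewrite (_ : box x y = \bigcap_(j : 'I_d) ((@tnth d R)^~ j @^-1` `[tnth x j, tnth y j[)).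
  apply: fin_bigcap_measurable => // j _; rewrite -[X in measurable X]setTI.
  exact: measurable_tnth.
by rewrite predeqE => t; split=> [H j _ | H j]; have := H j; rewrite /= in_itv; [|apply].
Qed.

Lemma measurable_star_discrepancy_le N d (dO : measure_display) (Omega : measurableType dO)
    (P : probability Omega R) (X : 'I_N -> {RV P >-> d.-tuple R}) (t : R) :
  measurable [set w | star_discrepancy (fun n => X n w) <= t].
Proof.
pose D w M (y : d.-tuple 'I_M.+2) :=
  discrepancy (fun n => X n w) (box (zero_tuple d) (corner y)).
rewrite (_ : [set w | _] = \bigcap_M \bigcap_(y : d.-tuple 'I_M.+2) [set w | D w M y <= t]).
  apply: bigcapT_measurable => M; apply: fin_bigcap_measurable => // y _.
  pose B := box (zero_tuple d) (corner y).
  have mB : measurable B by exact: measurable_box.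
  have mD : measurable_fun setT (fun w => D w M y).
    rewrite (_ : (fun w => D w M y) = fun w =>
      `|N%:R^-1 * \sum_(n < N) \1_B (X n w) - fine (lebesgue_tuple B)|).
      apply: measurableT_comp; first exact: normr_measurable.
      apply: measurable_funB => //; apply: measurable_funM => //.
      apply: measurable_sum => n; apply: measurableT_comp; last exact: measurable_funPT.
      exact: measurable_indic.
    apply/funext => w; rewrite /D /discrepancy; congr `|_ * _ - _|.
    rewrite -sum1_card natr_sum big_mkcond; apply: eq_bigr => n _.
    by rewrite indicE !inE; case: (_ \in _).
  rewrite (_ : [set w | _] = (fun w => D w M y) @^-1` `]-oo, t]).
    by rewrite -[X in measurable X]setTI; apply: mD.
  by rewrite predeqE => w /=; rewrite in_itv.
rewrite predeqE => w; split=> [/star_discrepancy_leP H M _ y _|H]; first exact: H.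
by apply/star_discrepancy_leP => M y; apply: H.
Qed.

End StarDiscrepancy.

(** * Joint law of the cells *)

Section CellLaw.
Context {R : realType} {dO : measure_display} {Omega : measurableType dO}.
Variable P : probability Omega R.
Implicit Types (N d : nat).

Lemma expect_tuple N (w : nat -> column N -> R) d (F : seq (column N) -> R) :
  \sum_(C : d.-tuple (column N)) (\prod_(j < d) w j (tnth C j)) * F C = expect w d F.
Proof.
elim: d w F => [|d IH] w F /=.
  rewrite (big_pred1 [tuple]) => [|C]; last by rewrite (tuple0 C); apply/esym/eqP.
  by rewrite big_ord0 mul1r.
under [RHS]eq_bigr do rewrite -IH mulr_sumr.
rewrite pair_bigA /= (reindex (fun q : column N * d.-tuple (column N) => [tuple of q.1 :: q.2])) /=.
  apply: eq_bigr => -[g C] _ /=; rewrite big_ord_recl tnth0 mulrA; congr (_ * _ * _).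
  by apply: eq_bigr => j _; rewrite tnthS.
exists (fun C => (thead C, [tuple of behead C])) => [[g C] _|C _] /=.
  by rewrite theadE; congr pair; apply/val_inj.
by rewrite -tuple_eta.
Qed.

Lemma measure_bigU_le (I : Type) (r : seq I) (Q : pred I) (F : I -> set Omega) :
  (forall i, measurable (F i)) ->
  (P (\big[setU/set0]_(i <- r | Q i) F i) <= \sum_(i <- r | Q i) P (F i))%E.
Proof.
move=> mF; elim: r => [|i r IH]; first by rewrite !big_nil measure0.
rewrite !big_cons; case: ifP => // _.
have mU : measurable (\big[setU/set0]_(j <- r | Q j) F j) by apply: bigsetU_measurable.
by apply: le_trans (measureU2 _ (mF i) mU) _; rewrite leeD2l.
Qed.

Definition cell N d (c : 'I_N -> 'I_d -> 'I_N) (n : 'I_N) : set (d.-tuple R) :=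
  box [tuple (c n j)%:R / N%:R | j < d] [tuple (c n j).+1%:R / N%:R | j < d].

Definition cell_event N d (X : 'I_N -> {RV P >-> d.-tuple R}) (C : d.-tuple (column N)) :
    set Omega :=
  [set w | in_cell (fun n => X n w) C].

Lemma in_cellE N d (p : 'I_N -> d.-tuple R) (C : d.-tuple (column N)) : (0 < N)%N ->
  in_cell p C <-> forall n, cell (fun n j => tnth C j n) n (p n).
Proof.
move=> N0; have NR : 0 < N%:R :> R by rewrite ltr0n.
by split=> H n j; have := H n j; rewrite !tnth_mktuple ler_pdivrMr // ltr_pdivlMr // mulrC.
Qed.

Lemma cell_eventE N d (X : 'I_N -> {RV P >-> d.-tuple R}) (C : d.-tuple (column N)) :
  (0 < N)%N ->
  cell_event X C = \bigcap_(n in [set: 'I_N]) (X n @^-1` cell (fun n j => tnth C j n) n).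
Proof.
move=> N0; rewrite predeqE => w; split=> [/(in_cellE _ _ N0) H n _|H]; first exact: H.
by apply/(in_cellE _ _ N0) => n; apply: H.
Qed.

Lemma measurable_cell_event N d (X : 'I_N -> {RV P >-> d.-tuple R}) (C : d.-tuple (column N)) :
  (0 < N)%N -> measurable (cell_event X C).
Proof.
move=> N0; rewrite cell_eventE //; apply: fin_bigcap_measurable => // n _.
rewrite -[X in measurable X]setTI; apply: measurable_funPT => //.
exact: measurable_box.
Qed.

Definition cell_law N d (X : 'I_N -> {RV P >-> d.-tuple R}) (w : nat -> column N -> R) : Prop :=
  forall C, P (cell_event X C) = (\prod_(j < d) w j (tnth C j))%:E.

Lemma cells_exist N d (p : 'I_N -> d.-tuple R) : (0 < N)%N ->
  (forall n, unit_cube (p n)) -> exists C, in_cell p C.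
Proof.
case: N p => // N p _ pu.
have NR : 0 < N.+1%:R :> R by rewrite ltr0n.
pose m n j := Num.truncn (N.+1%:R * tnth (p n) j).
have p01 n j : 0 <= tnth (p n) j < 1 by have := pu n j; rewrite !tnth_mktuple.
have mP n j : (m n j)%:R <= N.+1%:R * tnth (p n) j < (m n j).+1%:R.
  by apply: truncn_itv; rewrite mulr_ge0 //; case/andP: (p01 n j).
have mN n j : (m n j < N.+1)%N.
  rewrite -(ltr_nat R); case/andP: (mP n j) => /le_lt_trans + _; apply.
  by rewrite gtr_pMr //; case/andP: (p01 n j).
exists [tuple [ffun n => inord (m n j)] | j < d] => n j.
by rewrite tnth_mktuple ffunE inordK.
Qed.

(** The complementary event is covered by the cell events of the configurations
    that violate the bound on the grid. *)
Lemma star_discrepancy_prob N d (X : 'I_N -> {RV P >-> d.-tuple R}) w (t f : R) :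
  (0 < N)%N -> (forall n omega, unit_cube (X n omega)) -> cell_law X w ->
  Pr d w (fun l => ~~ grid_disc_le d t l) <= f ->
  ((1 - f)%:E <= P [set omega | (star_discrepancy (fun n => X n omega) <= t + d%:R / N%:R)%R])%E.
Proof.
move=> N0 Xu law bad.
set A := [set omega | _]; have mA : measurable A by exact: measurable_star_discrepancy_le.
pose U := \big[setU/set0]_(C : d.-tuple (column N) | ~~ grid_disc_le d t C) cell_event X C.
have mU : measurable U by apply: bigsetU_measurable => C _; exact: measurable_cell_event.
have AU : ~` A `<=` U.
  move=> omega /= nA; have [C XC] := cells_exist N0 (fun n => Xu n omega).
  have badC : ~~ grid_disc_le d t C.
    by apply/negP => good; apply: nA; exact: star_discrepancy_le_grid good.
  by rewrite /U (bigD1 C) //=; left.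
have PU : (P U <= f%:E)%E.
  apply: le_trans (measure_bigU_le _ _ (fun C => measurable_cell_event X C N0)) _.
  under eq_bigr do rewrite law; rewrite sumEFin lee_fin; apply: le_trans bad.
  rewrite /Pr -expect_tuple big_mkcond; apply: ler_sum => C _.
  by case: ifP => _; rewrite ?mulr1 ?mulr0.
have PA : (P (~` A) <= f%:E)%E.
  apply: le_trans PU; apply: le_measure => //; rewrite inE //; exact: measurableC.
have fA : P A \is a fin_num by exact: fin_num_measure.
move: PA; rewrite probability_setC // -(fineK fA) -EFinB !lee_fin; lra.
Qed.

Lemma monte_carlo_cell_law N d (X : 'I_N -> {RV P >-> d.-tuple R}) : (0 < N)%N ->
  monte_carlo P X -> cell_law X (fun=> @uniform_column R N).
Proof.
move=> N0 [unif indep] C; rewrite cell_eventE //.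
have NR : 0 < N%:R :> R by rewrite ltr0n.
pose c n j := tnth C j n.
have := indep [set: 'I_N]%SET (fun n => X n @^-1` cell c n).
rewrite (_ : [set` _] = [set: 'I_N]); last by rewrite predeqE => n /=; rewrite inE.
move=> ->; last first.
  by move=> n _; exists (cell c n); [exact: measurable_box | rewrite setTI].
transitivity (\prod_(n < N) ((N%:R^-1 : R) ^+ d)%:E)%E.
  apply: eq_big => [n|n _]; first by rewrite inE.
  have := unif n (cell c n) (measurable_box _ _); rewrite /distribution /pushforward => ->.
  rewrite (_ : _ `&` _ = cell c n); last first.
    rewrite predeqE => z; split=> [[]//|zc]; split=> // j; have := zc j.
    rewrite !tnth_mktuple => /andP[h1 h2]; apply/andP; split.
      by apply: le_trans h1; rewrite divr_ge0.
    by apply: lt_le_trans h2 _; rewrite ler_pdivrMr // mul1r ler_nat.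
  rewrite lebesgue_tuple_box => [|j]; last first.
    by rewrite !tnth_mktuple ler_pM2r ?invr_gt0 // ler_nat.
  congr (_%:E); rewrite -[d in RHS]card_ord -prodr_const; apply: eq_bigr => j _.
  by rewrite !tnth_mktuple -mulrBl -natrB // subSnn mul1r.
rewrite prodEFin !prodr_const !card_ord /uniform_column; congr (_%:E).
by rewrite -!exprM mulnC.
Qed.

(** A coordinate [(s n + U) / N] with [0 <= U < 1] lies in cell [s n], so that the
    cells only depend on the permutations. *)
Lemma latin_hypercube_cell_law N d (X : 'I_N -> {RV P >-> d.-tuple R}) : (0 < N)%N ->
  latin_hypercube P X -> cell_law X (fun=> @permutation_column R N).
Proof.
move=> N0 [s [U [unif_s unif_U indep XE]]] C.
have NR : 0 < N%:R :> R by rewrite ltr0n.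
pose S j := s j @^-1` [set t : {perm 'I_N} | finfun t = tnth C j].
have -> : cell_event X C = \bigcap_(j in [set: 'I_d]) S j.
  rewrite predeqE => w; split=> [H j _|H n j].
    apply/ffunP => n; rewrite ffunE; apply/val_inj/eqP => /=.
    have := H n j; rewrite XE mulrC divfK ?(gt_eqF NR) // => /andP[h1 h2].
    have [/(_ w)/andP[u0 u1] _] := unif_U n j.
    rewrite eqn_leq; apply/andP; split; rewrite -ltnS -(ltr_nat R).
      by apply: le_lt_trans h2; rewrite lerDl.
    by apply: le_lt_trans h1 _; rewrite -natr1 ltrD2l.
  have /ffunP/(_ n) := H j I; rewrite ffunE => <-.
  have [/(_ w)/andP[u0 u1] _] := unif_U n j.
  by rewrite XE mulrC divfK ?(gt_eqF NR) // lerDl u0 -natr1 ltrD2l.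
pose A (k : 'I_d + 'I_N * 'I_d) : set Omega := if k is inl j then S j else setT.
have := indep [set inl j | j : 'I_d]%SET A.
rewrite (_ : \bigcap_(i in _) A i = \bigcap_(j in [set: 'I_d]) S j); last first.
  rewrite predeqE => w; split=> [H j _|H k /= /imsetP[j _ ->]]; last exact: H.
  by apply: (H (inl j)); apply/imsetP; exists j.
move=> ->; last first.
  move=> _ /imsetP[j _ ->]; exists [set t : {perm 'I_N} | finfun t = tnth C j] => //.
  by rewrite setTI.
rewrite big_imset /=; last by move=> i j _ _ [].
rewrite -prodEFin; apply: eq_big => [j|j _]; first by rewrite inE.
rewrite /permutation_column.
case: (pickP (fun t : {perm 'I_N} => finfun t == tnth C j)) => [t /eqP tC|none].
  rewrite (big_pred1 t) => [|t']; last first.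
    apply/eqP/eqP => [|-> //]; rewrite -tC => /ffunP E.
    by apply/permP => n; have := E n; rewrite !ffunE.
  rewrite /S (_ : [set _ | _] = [set t]); first exact: unif_s.
  rewrite predeqE => t'; split=> [|-> //] /=; rewrite -tC => /ffunP E.
  by apply/permP => n; have := E n; rewrite !ffunE.
rewrite big_pred0 // /S (_ : [set _ | _] = set0) ?preimage_set0 ?measure0 //.
by rewrite predeqE => t; split=> // /eqP; rewrite none.
Qed.

(** Split the columns into those of the two parts of the points. *)
Lemma padded_latin_hypercube_cell_law N d (X : 'I_N -> {RV P >-> d.-tuple R}) : (0 < N)%N ->
  padded_latin_hypercube P X -> exists2 w, cell_law X w & forall j, column_neg_dep (w j).
Proof.
move=> N0 [d1 [d2 [Y [V [[_ _ dE] lhs mc indep XE]]]]]; subst d.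
have NR : 0 < N%:R :> R by rewrite ltr0n.
pose w j := if (j < d1)%N then @permutation_column R N else @uniform_column R N.
exists w; last first.
  move=> j; rewrite /w; case: ifP => _.
    exact: permutation_column_neg_dep.
  exact: uniform_column_neg_dep.
move=> C.
pose C1 : d1.-tuple (column N) := [tuple tnth C (lshift d2 j) | j < d1].
pose C2 : d2.-tuple (column N) := [tuple tnth C (rshift d1 j) | j < d2].
pose good e (D : e.-tuple (column N)) : set (N.-tuple (e.-tuple R)) :=
  \bigcap_(n in [set: 'I_N]) ((@tnth N (e.-tuple R))^~ n @^-1` cell (fun n j => tnth D j n) n).
have mgood e (D : e.-tuple (column N)) : measurable (good e D).
  apply: fin_bigcap_measurable => // n _; rewrite -[X in measurable X]setTI.
  apply: measurable_tnth => //; exact: measurable_box.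
have goodE e (D : e.-tuple (column N)) (Z : 'I_N -> {RV P >-> e.-tuple R}) :
    joint Z @^-1` good e D = cell_event Z D.
  rewrite predeqE => om; split=> [H|/(in_cellE _ _ N0) H n _].
    by apply/(in_cellE _ _ N0) => n; have := H n I; rewrite /= tnth_mktuple.
  by rewrite /= tnth_mktuple; exact: H.
have -> : cell_event X C = (joint Y @^-1` good _ C1) `&` (joint V @^-1` good _ C2).
  rewrite !goodE predeqE => om; split=> [H|[H1 H2] n j].
    split=> n j; rewrite tnth_mktuple.
      have := H n (lshift d2 j); rewrite (tnth_nth 0) XE nth_cat size_tuple /= ltn_ord.
      by rewrite -tnth_nth.
    have := H n (rshift d1 j); rewrite (tnth_nth 0) XE nth_cat size_tuple /=.
    by rewrite ltnNge leq_addr /= addKn -tnth_nth.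
  case: (split_ordP j) => k ->.
    have := H1 n k; rewrite tnth_mktuple [tnth (X n om) _](tnth_nth 0) XE.
    rewrite nth_cat size_tuple /= ltn_ord.
    by rewrite -tnth_nth.
  have := H2 n k; rewrite tnth_mktuple [tnth (X n om) _](tnth_nth 0) XE.
  rewrite nth_cat size_tuple /=.
  by rewrite ltnNge leq_addr /= addKn -tnth_nth.
rewrite indep // !goodE (latin_hypercube_cell_law N0 lhs) (monte_carlo_cell_law N0 mc).
rewrite -EFinM big_split_ord /=; congr (_ * _)%:E; apply: eq_bigr => j _.
  by rewrite tnth_mktuple /w /= ltn_ord.
by rewrite tnth_mktuple /w /= ltnNge leq_addr.
Qed.

End CellLaw.

(** * Numerical constants and conclusion *)

Section Numerals.
Variable R : realFieldType.

(** A large numeral stands for a natural number given by its decimal digits;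
    its image in a field is computed here from the digits, without passing
    through the unary number. *)
Fixpoint decimal_value (u : Decimal.uint) (acc : R) : R :=
  match u with
  | Decimal.Nil => acc
  | Decimal.D0 u => decimal_value u (10 * acc)
  | Decimal.D1 u => decimal_value u (10 * acc + 1)
  | Decimal.D2 u => decimal_value u (10 * acc + 2)
  | Decimal.D3 u => decimal_value u (10 * acc + 3)
  | Decimal.D4 u => decimal_value u (10 * acc + 4)
  | Decimal.D5 u => decimal_value u (10 * acc + 5)
  | Decimal.D6 u => decimal_value u (10 * acc + 6)
  | Decimal.D7 u => decimal_value u (10 * acc + 7)
  | Decimal.D8 u => decimal_value u (10 * acc + 8)
  | Decimal.D9 u => decimal_value u (10 * acc + 9)
  end.

Lemma natr_of_uint u : (Nat.of_num_uint (Number.UIntDecimal u))%:R = decimal_value u 0 :> R.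
Proof.
rewrite /= /Nat.of_uint -[0 in RHS]/(0%:R).
have addE m n : Nat.tail_add m n = (m + n)%N by elim: m n => //= m IH n; rewrite IH addnS.
have E n : Nat.tail_mul 10 n = (10 * n)%N by rewrite /Nat.tail_mul /= !addE; lia.
elim: u 0%N => //= u IH n; rewrite IH E; congr decimal_value;
  by rewrite -?natr1 natrM; ring.
Qed.

Local Notation num u := ((Nat.of_num_uint (Number.UIntDecimal u))%:R : R).

Lemma le_ratio_of_uint u v (x : R) : 0 < decimal_value v 0 ->
  x * decimal_value v 0 <= decimal_value u 0 -> x <= num u / num v.
Proof. by rewrite -!natr_of_uint => v0 xv; rewrite ler_pdivlMr. Qed.

Lemma ratio_of_uint_le u v (x : R) : 0 < decimal_value v 0 ->
  decimal_value u 0 <= x * decimal_value v 0 -> num u / num v <= x.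
Proof. by rewrite -!natr_of_uint => v0 xv; rewrite ler_pdivrMr. Qed.

End Numerals.

Section Main.
Variable R : realType.

Lemma expRN_le_pow k (x y z : R) : k%:R + y <= x -> 0 <= y -> 1 <= z * (1 + y) ->
  expR (- x) <= (10 / 27) ^+ k * z.
Proof.
move=> kx y0 zy; apply: (@le_trans _ _ (expR (- (k%:R + y)))).
  by rewrite ler_expR lerN2.
rewrite opprD expRD; apply: ler_pM; rewrite ?expR_ge0 //.
  rewrite -mulrN1 expRM_natl lerXn2r ?nnegrE ?expR_ge0 ?divr_ge0 //.
  by rewrite expRN -[leLHS]div1r ler_pdivrMr ?expR_gt0 //; have := @expR1_ge R; lra.
have z0 : 0 <= z by rewrite -(pmulr_lge0 _ (_ : 0 < 1 + y)) ?(le_trans ler01) //; lra.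
rewrite expRN -[leLHS]div1r ler_pdivrMr ?expR_gt0 //; apply: le_trans zy _.
by rewrite ler_wpM2l ?expR_ge1Dx.
Qed.

(** The numerical conditions under which the deviation [c * rho] has failure
    probability at most [f], for large and for small [rho]. *)
Definition admissible (c f : R) :=
  [/\ 5 / 2 <= c,
      expR 1 * (2 ^+ 8 + 1) * expR (- (2 * (c - 41 / 100) ^+ 2)) <= 1,
      expR 1 * (2 ^+ 12 + 1) * expR (- (2 * (c - 3 / 10) ^+ 2)) <= 1,
      2 * (2 ^+ 8 + 1) * expR (- (2 * (c - 41 / 100) ^+ 2)) <= f
    & 2 * (2 ^+ 12 + 1) * expR (- (2 * (c - 3 / 10) ^+ 2)) + 1 / 10 ^+ 8 <= f].

Lemma admissible_intro (c f e1 e2 : R) : 5 / 2 <= c ->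
  expR (- (2 * (c - 41 / 100) ^+ 2)) <= e1 -> expR (- (2 * (c - 3 / 10) ^+ 2)) <= e2 ->
  3 * (2 ^+ 8 + 1) * e1 <= 1 -> 3 * (2 ^+ 12 + 1) * e2 <= 1 ->
  2 * (2 ^+ 8 + 1) * e1 <= f -> 2 * (2 ^+ 12 + 1) * e2 + 1 / 10 ^+ 8 <= f ->
  admissible c f.
Proof.
move=> c1 h1 h2 a1 a2 b1 b2; rewrite /admissible.
have E3 := @expR1_le R; have E0 := expR_ge0 (1 : R).
move: h1 h2 (expR_ge0 (- (2 * (c - 41 / 100) ^+ 2))) (expR_ge0 (- (2 * (c - 3 / 10) ^+ 2))).
move: (expR (- (2 * (c - 41 / 100) ^+ 2))) (expR (- (2 * (c - 3 / 10) ^+ 2))) => E1 E2.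
move: (expR 1) E3 E0 => E E3 E0 h1 h2 E10 E20.
have k1 : E * E1 <= 3 * e1 by apply: ler_pM.
have k2 : E * E2 <= 3 * e2 by apply: ler_pM.
by split; lra.
Qed.

Lemma admissible_252 : admissible (252 / 100) (3 / 5).
Proof.
apply: (@admissible_intro _ _ ((10 / 27) ^+ 8 * 1) ((10 / 27) ^+ 9 * (5 / 9))).
- lra.
- by apply: (@expRN_le_pow _ _ 0); lra.
- by apply: (@expRN_le_pow _ _ (8 / 10)); lra.
all: lra.
Qed.

Lemma admissible_3 : admissible 3 (127 / 10 ^+ 4).
Proof.
apply: (@admissible_intro _ _ ((10 / 27) ^+ 13 * 1) ((10 / 27) ^+ 14 * 1)).
- lra.
- by apply: (@expRN_le_pow _ _ 0); lra.
- by apply: (@expRN_le_pow _ _ 0); lra.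
all: lra.
Qed.

Lemma admissible_4 : admissible 4 (1 / 10 ^+ 6).
Proof.
apply: (@admissible_intro _ _ ((10 / 27) ^+ 25 * 1) ((10 / 27) ^+ 27 * 1)).
- lra.
- by apply: (@expRN_le_pow _ _ 0); lra.
- by apply: (@expRN_le_pow _ _ 0); lra.
all: lra.
Qed.

Lemma Pr_admissible N d (w : nat -> column N -> R) (c f : R) : (0 < N)%N -> (0 < d)%N ->
  (forall j, column_neg_dep (w j)) -> admissible c f ->
  c * Num.sqrt (d%:R / N%:R) <= 1 ->
  Pr d w (fun l => ~~ grid_disc_le d (c * Num.sqrt (d%:R / N%:R) - d%:R / N%:R) l) <= f.
Proof.
move=> N0 d0 wnd [c1 s1 s2 f1 f2] crho.
rewrite -[X in _ - X](@sqr_sqrtr _ (d%:R / N%:R)) ?divr_ge0 //.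
have [rho1|rho1] := leP (1 / 100 : R) (Num.sqrt (d%:R / N%:R)).
  by apply: le_trans f1; apply: Pr_coarse.
apply: le_trans f2; apply: Pr_fine => //; [lra | exact: ltW].
Qed.

Lemma star_discrepancy_le1 N d (p : 'I_N -> d.-tuple R) : star_discrepancy p <= 1.
Proof. by apply: star_discrepancy_le => z zc; exact: discrepancy_le1. Qed.

Lemma star_discrepancy_prob_admissible (dO : measure_display) (Omega : measurableType dO)
    (P : probability Omega R) N d (X : 'I_N -> {RV P >-> d.-tuple R}) w (c f : R) :
  (0 < N)%N -> (0 < d)%N -> (forall n omega, unit_cube (X n omega)) -> cell_law X w ->
  (forall j, column_neg_dep (w j)) -> admissible c f -> 0 <= f ->
  ((1 - f)%:E <= P [set omega |
     (star_discrepancy (fun n => X n omega) <= c * Num.sqrt (d%:R / N%:R))%R])%E.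
Proof.
move=> N0 d0 Xu law wnd adm f0.
have [crho|crho] := leP (c * Num.sqrt (d%:R / N%:R)) 1.
  have := star_discrepancy_prob N0 Xu law (Pr_admissible N0 d0 wnd adm crho).
  by rewrite subrK.
rewrite [X in P X](_ : _ = setT) ?probability_setT ?lee_fin; first lra.
rewrite predeqE => om; split=> // _ /=.
exact: le_trans (star_discrepancy_le1 _) (ltW crho).
Qed.

Lemma probabilistic_bounds (dO : measure_display) (Omega : measurableType dO)
    (P : probability Omega R) N d (X : 'I_N -> {RV P >-> d.-tuple R}) w (c f3 f4 : R) :
  (0 < N)%N -> (0 < d)%N -> (forall n omega, unit_cube (X n omega)) -> cell_law X w ->
  (forall j, column_neg_dep (w j)) ->
  252 / 100 <= c -> f3 <= 1 - 127 / 10 ^+ 4 -> f4 <= 1 - 1 / 10 ^+ 6 ->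
  [/\ exists p : 'I_N -> d.-tuple R,
        [/\ realization X p, forall n, unit_cube (p n)
          & star_discrepancy p <= c * Num.sqrt (d%:R / N%:R)],
      (f3%:E <= P [set om | (star_discrepancy (fun n => X n om)
                               <= 3 * Num.sqrt (d%:R / N%:R))%R])%E
    & (f4%:E <= P [set om | (star_discrepancy (fun n => X n om)
                               <= 4 * Num.sqrt (d%:R / N%:R))%R])%E].
Proof.
move=> N0 d0 Xu law wnd c1 h3 h4; split.
- have := star_discrepancy_prob_admissible N0 d0 Xu law wnd admissible_252 _.
  set A := [set om | _] => H.
  have [om Aom] : A !=set0.
    apply/set0P/eqP => A0; move: (H ltac:(lra)); rewrite A0 measure0 lee_fin; lra.
  exists (fun n => X n om); split; [by exists om | by move=> n; exact: Xu |].
  by apply: le_trans Aom _; rewrite ler_wpM2r ?sqrtr_ge0.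
- apply: le_trans (star_discrepancy_prob_admissible N0 d0 Xu law wnd admissible_3 _).
    by rewrite lee_fin.
  lra.
- apply: le_trans (star_discrepancy_prob_admissible N0 d0 Xu law wnd admissible_4 _).
    by rewrite lee_fin.
  lra.
Qed.

Lemma expect_uniform1 N d : (0 < N)%N -> expect (fun=> @uniform_column R N) d (fun=> 1) = 1.
Proof.
move=> N0; elim: d => //= d IH.
under eq_bigr do rewrite IH mulr1.
rewrite (eq_bigl (fun g : column N => [forall n, g n \in [set: 'I_N]%SET])) => [|g]; last first.
  by apply/esym/forallP => n; rewrite inE.
rewrite uniform_column_family.
by rewrite big1 // => n _; rewrite cardsT card_ord mulfV // pnatr_eq0 -lt0n.
Qed.

(** The probabilistic method with all cell configurations equally likely; the
    points are the lower corners of their cells. *)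
Lemma low_discrepancy_points N d : (0 < N)%N -> (0 < d)%N ->
  252 / 100 * Num.sqrt (d%:R / N%:R) <= 1 :> R ->
  exists2 p : 'I_N -> d.-tuple R, forall n, unit_cube (p n) &
    star_discrepancy p <= 252 / 100 * Num.sqrt (d%:R / N%:R).
Proof.
move=> N0 d0 crho.
have := Pr_admissible N0 d0 (fun=> uniform_column_neg_dep R N) admissible_252 crho.
set t := _ - _ => bad.
have [C goodC] : exists C : d.-tuple (column N), grid_disc_le d t C.
  apply: contrapT => none; suff : 1 <= (3 / 5 : R) by lra.
  apply: le_trans bad; rewrite -[leLHS](expect_uniform1 d N0).
  apply: expect_le => [j g|l sl]; first by case: (uniform_column_neg_dep R N).
  rewrite (_ : ~~ grid_disc_le d t l) //; apply/negP => good; apply: none.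
  have sl' : size l == d by apply/eqP.
  by exists (Tuple sl').
have NR : 0 < N%:R :> R by rewrite ltr0n.
pose p n : d.-tuple R := [tuple (tnth C j n)%:R / N%:R | j < d].
exists p.
  move=> n j; rewrite !tnth_mktuple divr_ge0 //= ltr_pdivrMr // mul1r ltr_nat.
  exact: ltn_ord.
have pC : in_cell p C.
  by move=> n j; rewrite tnth_mktuple mulrC divfK ?(gt_eqF NR) // lexx ltr_nat /=.
by have := star_discrepancy_le_grid N0 pC goodC; rewrite /t subrK.
Qed.

Lemma min_star_discrepancy_le N d (p : 'I_N -> d.-tuple R) : (0 < N)%N ->
  (forall n, unit_cube (p n)) -> min_star_discrepancy N d <= star_discrepancy p.
Proof.
move=> N0 pu; rewrite /min_star_discrepancy eqn0Ngt N0 /=.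
apply: ge_inf; last by exists p.
by exists 0 => _ [q _ <-]; exact: star_discrepancy_ge0.
Qed.

(** For [eps >= 1] the empty set is good enough.  Otherwise [N] points with [N]
    the ceiling satisfy [252 / 100 * rho <= eps]. *)
Lemma inverse_star_discrepancy_le d (eps c : R) : (0 < d)%N -> 0 < eps ->
  (252 / 100) ^+ 2 <= c ->
  (inverse_star_discrepancy eps d <= ((Num.ceil (c * d%:R * eps ^- 2))%:~R%R)%:E)%E.
Proof.
move=> d0 eps0 c0.
have dR : 0 < d%:R :> R by rewrite ltr0n.
have cpos : 0 < c by apply: lt_le_trans c0; rewrite exprn_gt0 // divr_gt0.
set x := c * d%:R * eps ^- 2.
have x0 : 0 < x by rewrite !mulr_gt0 ?invr_gt0 ?exprn_gt0.
have cx0 : (0 < Num.ceil x)%R.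
  by rewrite -(ltr_int R); apply: lt_le_trans x0 (ceil_ge _).
apply: ge_ereal_inf.
have [eps1|eps1] := leP 1 eps.
  exists 0%:R%:E; first by exists 0%N.
  by rewrite lee_fin ler0z ltW.
pose N := `|Num.ceil x|%N.
have NE : (N%:R : R) = (Num.ceil x)%:~R by rewrite natr_absz gtr0_norm.
have N0 : (0 < N)%N by rewrite absz_gt0 gt_eqF.
exists N%:R%:E; last by rewrite NE.
exists N => //=.
have xN : x <= N%:R by rewrite NE ceil_ge.
have NR : 0 < N%:R :> R by rewrite ltr0n.
have crho : 252 / 100 * Num.sqrt (d%:R / N%:R) <= eps :> R.
  rewrite -(@ler_pXn2r _ 2) ?nnegrE ?(ltW eps0) ?mulr_ge0 ?sqrtr_ge0 ?divr_ge0 //.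
  rewrite exprMn sqr_sqrtr ?divr_ge0 // mulrA ler_pdivrMr //.
  apply: le_trans (ler_wpM2l _ xN); last by rewrite exprn_ge0 // ltW.
  rewrite /x [leRHS]mulrC mulfVK ?gt_eqF ?exprn_gt0 //.
  by rewrite ler_wpM2r // ltW.
have [p pu pd] := low_discrepancy_points N0 d0 (le_trans crho (ltW eps1)).
exact: le_trans (min_star_discrepancy_le N0 pu) (le_trans pd crho).
Qed.

End Main.

Theorem corollary4p5 (R : realType) :
  (forall (d N : nat) (hd : (0 < d)%N) (hN : (0 < N)%N)
     (dO : measure_display) (Omega : measurableType dO)
     (P : probability Omega R) (X : 'I_N -> {RV P >-> d.-tuple R})
     (hX : forall n w, unit_cube (X n w)),
     (monte_carlo P X ->
       [/\ exists p : 'I_N -> d.-tuple R,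
             [/\ realization X p, forall n, unit_cube (p n)
               & star_discrepancy p
                 <= 25287%:R / 10000%:R * Num.sqrt (d%:R / N%:R)],
           ((987256%:R / 1000000%:R)%:E <=
             P [set w | (star_discrepancy (fun n => X n w)
                           <= 3 * Num.sqrt (d%:R / N%:R))%R])%E
         & ((999999%:R / 1000000%:R)%:E <=
             P [set w | (star_discrepancy (fun n => X n w)
                           <= 4 * Num.sqrt (d%:R / N%:R))%R])%E])
     /\
     (latin_hypercube P X \/ padded_latin_hypercube P X ->
       [/\ exists p : 'I_N -> d.-tuple R,
             [/\ realization X p, forall n, unit_cube (p n)
               & star_discrepancy p
                 <= 26442%:R / 10000%:R * Num.sqrt (d%:R / N%:R)],
           ((965358%:R / 1000000%:R)%:E <=
             P [set w | (star_discrepancy (fun n => X n w)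
                           <= 3 * Num.sqrt (d%:R / N%:R))%R])%E
         & ((999999%:R / 1000000%:R)%:E <=
             P [set w | (star_discrepancy (fun n => X n w)
                           <= 4 * Num.sqrt (d%:R / N%:R))%R])%E]))
  /\
  (forall (d : nat) (hd : (0 < d)%N) (eps : R) (heps : 0 < eps),
     (inverse_star_discrepancy eps d <=
       ((Num.ceil (63944%:R / 10000%:R * d%:R * eps ^- 2))%:~R%R)%:E)%E).
Proof.
have c1 : 252 / 100 <= 25287%:R / 10000%:R :> R by apply: le_ratio_of_uint => /=; lra.
have c2 : 252 / 100 <= 26442%:R / 10000%:R :> R by apply: le_ratio_of_uint => /=; lra.
have f1 : 987256%:R / 1000000%:R <= 1 - 127 / 10 ^+ 4 :> R.
  by apply: ratio_of_uint_le => /=; lra.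
have f2 : 965358%:R / 1000000%:R <= 1 - 127 / 10 ^+ 4 :> R.
  by apply: ratio_of_uint_le => /=; lra.
have f3 : 999999%:R / 1000000%:R <= 1 - 1 / 10 ^+ 6 :> R.
  by apply: ratio_of_uint_le => /=; lra.
have e1 : (252 / 100) ^+ 2 <= 63944%:R / 10000%:R :> R.
  by apply: le_ratio_of_uint => /=; lra.
split=> [d N d0 N0 dO Omega P X Xu|d d0 eps eps0]; last first.
  exact (inverse_star_discrepancy_le d0 eps0 e1).
split=> [mc|[lhs|padded]].
- exact (probabilistic_bounds N0 d0 Xu (monte_carlo_cell_law N0 mc)
    (fun=> uniform_column_neg_dep R N) c1 f1 f3).
- exact (probabilistic_bounds N0 d0 Xu (latin_hypercube_cell_law N0 lhs)
    (fun=> permutation_column_neg_dep R N) c2 f2 f3).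
- have [w law wnd] := padded_latin_hypercube_cell_law N0 padded.
  exact (probabilistic_bounds N0 d0 Xu law wnd c2 f2 f3).
Qed.
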